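(* Let $\mathcal F$ be a complete pointed fan in Euclidean space $\mathbb E^d$. A canonical scaling of $\mathcal F$ exists if and only if $\mathcal F$ is polytopal.
   Context: A polyhedral cone in $\mathbb E^d$ is a set $\{p+\alpha_1 v_1+\dots+\alpha_k v_k : \alpha_i\ge 0\}$ for a point $p$ and finitely many vectors $v_i$. A fan in $\mathbb E^d$ is a finite family of polyhedral cones such that every (nonempty) face of a cone of the family belongs to the family and the intersection of any two cones of the family is a nonempty face of each of them. The cones of a fan are called its faces. A fan is complete if its cones cover $\mathbb E^d$, and pointed if its minimal cone (the one contained in all others) is a single point, called the vertex. The $d$-dimensional cones are called cells, the $(d-1)$-dimensional ones hyperfaces, the $(d-2)$-dimensional ones coribs. For a point $v$ and a set $M$, $\mathrm{cone}_v(M)=\{v+\sum_{i=1}^k\alpha_i\overrightarrow{vp_i} : \alpha_i\ge0,\ p_i\in M\}$ (finite sums, with $\mathrm{cone}_v(\emptyset)=\{v\}$). For a convex $d$-dimensional polytope $M\subset\mathbb E^d$ and an interior point $v$ of $M$, the face fan of $M$ is $\{\mathrm{cone}_v(F): F \text{ a proper face of } M\}$ (the empty face included). A fan is polytopal if it is the face fan of some polytope $M$ with respect to some interior point $v$ of $M$. A scaling is a positive real function $s$ on the set of hyperfaces. Let $R$ be a corib, let $C_1,\dots,C_k$ be the cells containing $R$ listed in cyclic order around $R$ (in one of the two directions, as seen in the projection along the affine hull of $R$ to a complementary plane), let $H_i=C_i\cap C_{i+1}$ (with $C_{k+1}=C_1$) be the hyperfaces containing $R$, and let $\mathbf n_i$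 be the unit normal to $H_i$ directed from $C_i$ to $C_{i+1}$. The torsion of $s$ around $R$ is $\Delta_s(R)=\sum_{i=1}^k s(H_i)\mathbf n_i$ (defined up to sign). The scaling $s$ is canonical if $\Delta_s(R)=0$ for every corib $R$. *)

(* Defs.v *)
From mathcomp Require Import all_boot all_order all_algebra.
From mathcomp Require Import all_classical all_reals all_analysis.

Set Implicit Arguments.
Unset Strict Implicit.
Unset Printing Implicit Defensive.

Import Order.TTheory GRing.Theory Num.Theory.
Import numFieldNormedType.Exports.

Local Open Scope classical_set_scope.
Local Open Scope ring_scope.

Section Fans.
Context {R : realType} {d : nat}.

(* Euclidean space E^d is 'rV[R]_d with the scalar product below. The library
   norm on 'rV[R]_d is the sup norm: only its topology is used (interior A°),
   never its metric. *)
Local Notation E := 'rV[R]_d.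
Implicit Types (A B C D H K M : set E) (F : set (set E)) (s : set E -> R).

Definition dot (x y : E) : R := \sum_(i < d) x 0 i * y 0 i.

(* [U] is the direction (parallel linear subspace) of the affine hull of [A]. *)
Definition direction A (U : {vspace E}) : Prop :=
  (forall x y, A x -> A y -> y - x \in U) /\
  (forall W : {vspace E}, (forall x y, A x -> A y -> y - x \in W) ->
     (U <= W)%VS).

Definition has_dim A (m : nat) : Prop :=
  A !=set0 /\ exists2 U : {vspace E}, direction A U & \dim U = m.

Definition polyhedral_cone A : Prop :=
  exists (p : E) (k : nat) (v : 'I_k -> E),
    A = [set x | exists2 a : 'I_k -> R,
           (forall i, 0 <= a i) & x = p + \sum_(i < k) a i *: v i].

Definition polytope A : Prop :=
  exists (k : nat) (p : 'I_k -> E),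
    A = [set x | exists a : 'I_k -> R,
           [/\ forall i, 0 <= a i, \sum_(i < k) a i = 1 &
               x = \sum_(i < k) a i *: p i]].

(* [B] is a face of [A]: the set where a linear inequality valid on [A] is an
   equality. For [c = 0] this gives the faces [A] (with [b = 0]) and [set0]
   (with [b = 1]). *)
Definition face A B : Prop :=
  exists (c : E) (b : R),
    (forall x, A x -> dot c x <= b) /\ B = A `&` [set x | dot c x = b].

Definition fan F : Prop :=
  [/\ finite_set F,
      forall C, F C -> polyhedral_cone C,
      forall C A, F C -> face C A -> A !=set0 -> F A &
      forall C D, F C -> F D ->
        [/\ C `&` D !=set0, face C (C `&` D) & face D (C `&` D)]].

Definition complete_fan F : Prop := \bigcup_(C in F) C = setT.

Definition pointed_fan F : Prop :=
  exists2 v : E, F [set v] & forall C, F C -> C v.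

(* Codimension is expressed additively, so that for d < 2 (resp. d = 0) there
   are no coribs (resp. hyperfaces). *)
Definition codim_face F (c : nat) A : Prop :=
  F A /\ exists2 m : nat, has_dim A m & (m + c)%N = d.

Definition cell F A : Prop := codim_face F 0 A.
Definition hyperface F A : Prop := codim_face F 1 A.
Definition corib F A : Prop := codim_face F 2 A.

Definition cone_at (v : E) M : set E :=
  [set x | exists (k : nat) (p : 'I_k -> E) (a : 'I_k -> R),
     [/\ forall i, M (p i), forall i, 0 <= a i &
         x = v + \sum_(i < k) a i *: (p i - v)]].

Definition face_fan M (v : E) : set (set E) :=
  [set C | exists B, [/\ face M B, B <> M & C = cone_at v B]].

Definition polytopal_fan F : Prop :=
  exists M (v : E),
    [/\ polytope M, has_dim M d, M° v & F = face_fan M v].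

(* Only the values of [s] on hyperfaces are meaningful. *)
Definition fan_scaling F s : Prop := forall H, hyperface F H -> 0 < s H.

(* [C 0, ..., C (k-1)] are the cells of [F] containing the corib [K], each
   listed once, in cyclic order around [K]. The vectors [e1], [e2] span a plane
   complementary to the direction [U] of the affine hull of [K]. Interior
   points [x i] of the cells are projected along [U] to that plane, with [p] in
   [K] sent to the origin, and their images have polar coordinates
   [(r i, th i)] in the basis [(e1, e2)], with increasing angles within one
   turn. Exchanging [e1] and [e2] gives the other direction of rotation. *)
Definition cyclic_cells F K (k : nat) (C : 'I_k -> set E) : Prop :=
  [/\ injective C,
      forall A, (cell F A /\ K `<=` A) <-> exists i, A = C i &
      exists (U : {vspace E}) (e1 e2 p : E)
             (x : 'I_k -> E) (r th : 'I_k -> R),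
        [/\ direction K U,
            (U + <[e1]> + <[e2]> = fullv)%VS,
            K p,
            (forall i, [/\ (C i)° (x i), 0 < r i &
               (x i - p) - r i *: (cos (th i) *: e1 + sin (th i) *: e2) \in U])
          & (forall i j : 'I_k, (i < j)%N -> th i < th j < th i + 2 * pi)]].

(* [n] is the unit normal to [H] directed from [C] to [D]. *)
Definition unit_normal H C D (n : E) : Prop :=
  [/\ dot n n = 1,
      forall x y, H x -> H y -> dot n (y - x) = 0,
      forall x y, H x -> C y -> dot n (y - x) <= 0 &
      forall x y, H x -> D y -> 0 <= dot n (y - x)].

(* [t] is the torsion of [s] around [K], for one of the two directions of
   rotation. The torsion is defined only up to sign, hence a relation;
   [ordS i] is the cyclic successor of [i] in 'I_k. *)
Definition torsion F s K (t : E) : Prop :=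
  exists (k : nat) (C : 'I_k -> set E) (n : 'I_k -> E),
    [/\ cyclic_cells F K C,
        forall i, unit_normal (C i `&` C (ordS i)) (C i) (C (ordS i)) (n i) &
        t = \sum_(i < k) s (C i `&` C (ordS i)) *: n i].

Definition canonical_scaling F s : Prop := forall K, corib F K -> torsion F s K 0.

End Fans.

(* Main.v *)
Require Import Defs.
From mathcomp Require Import all_boot all_order all_algebra.
From mathcomp Require Import all_classical all_reals all_analysis.
From mathcomp Require Import lra ring zify.

Set Implicit Arguments.
Unset Strict Implicit.
Unset Printing Implicit Defensive.

Import Order.TTheory GRing.Theory Num.Theory.
Import numFieldNormedType.Exports.

Local Open Scope classical_set_scope.
Local Open Scope ring_scope.

(** A scaling s prescribes, for each pair of cells C, D meeting in a hyperface H,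
the vector s(H) n, where n is the unit normal of H directed from C to D. Both
properties of the theorem amount to the existence of vectors a(C), one for each
cell, such that every cell C is exactly the set where the linear form a(C),
taken from the vertex v, is the largest of all the a(D): a strictly convex
piecewise linear function on the fan ([support_vectors]).

From a canonical scaling to the a(C). The equations a(D) - a(C) = s(H) n form an
inhomogeneous system on the adjacency graph of the cells. Around a corib they
are compatible, because the torsion is the sum of the prescribed jumps along the
cycle of cells; so they can be solved in the star of every point that avoids the
faces of codimension at least 3 ([nice_codim2]). Cutting by hyperplanes propagates them
from stars to compact convex sets of such points ([compact_exact]): two
solutions on the halves of a convex set differ, on the cells that meet the
cutting hyperplane, by a constant. Triangles with vertices in general position
avoid these faces as well, and gluing along segments from one base point
gives a solution on the whole fan ([potential]). Positivity of s makes the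
solution strictly convex ([support_of_potential]): a generic segment from a cell
C to a point x outside C leaves C through a hyperface, and the next cell D
satisfies a(D) > a(C) at x.

From the a(C) to a polytope. Subtracting the mean of the a(C) makes the function
f = max a(C) positive away from v, as the fan is pointed. Then M, the set where
f is at most 1, is the convex hull of v and of the generators of the cells
normalised to f = 1, and its face fan is the given one
([polytopal_of_support]). Conversely, the faces that span the cells of a face
fan are cut out by equations a(C) = 1 with a(C) at most 1 on M, and these a(C)
have the required property ([support_of_polytopal]).

From the a(C) to a canonical scaling, s(H) is the length of a(D) - a(C); the
torsion around a corib is then a telescoping sum ([canonical_of_support]). This
needs a cyclic listing of the cells around each corib ([cyclic_exists]). In both
directions the geometry around a corib is that of a complete fan of angles in a
plane, where consecutive cells of a listing, and no others, are adjacent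
([cyclic_adj]). *)

(** * The scalar product and cones as intersections of half-spaces *)

Section Basics.
Context {R : realType} {d : nat}.
Local Notation E := 'rV[R]_d.
Implicit Types (x y z w : E) (A B C D K : set E).

Lemma dotC x y : dot x y = dot y x.
Proof. by apply: eq_bigr => i _; rewrite mulrC. Qed.

Lemma dotDl x y z : dot (x + y) z = dot x z + dot y z.
Proof. by rewrite -big_split; apply: eq_bigr => i _; rewrite !mxE mulrDl. Qed.

Lemma dotZl a x y : dot (a *: x) y = a * dot x y.
Proof. by rewrite mulr_sumr; apply: eq_bigr => i _; rewrite !mxE mulrA. Qed.

Lemma dotNl x y : dot (- x) y = - dot x y.
Proof. by rewrite -scaleN1r dotZl mulN1r. Qed.

Lemma dotBl x y z : dot (x - y) z = dot x z - dot y z.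
Proof. by rewrite dotDl dotNl. Qed.

Lemma dotDr x y z : dot z (x + y) = dot z x + dot z y.
Proof. by rewrite !(dotC z) dotDl. Qed.

Lemma dotZr a x y : dot x (a *: y) = a * dot x y.
Proof. by rewrite !(dotC x) dotZl. Qed.

Lemma dotNr x y : dot x (- y) = - dot x y.
Proof. by rewrite !(dotC x) dotNl. Qed.

Lemma dotBr x y z : dot z (x - y) = dot z x - dot z y.
Proof. by rewrite !(dotC z) dotBl. Qed.

Lemma dot0l x : dot 0 x = 0.
Proof. by rewrite -(scale0r x) dotZl mul0r. Qed.

Lemma dot0r x : dot x 0 = 0.
Proof. by rewrite dotC dot0l. Qed.

Lemma dot_sumr I (r : seq I) (P : pred I) (f : I -> E) x :
  dot x (\sum_(i <- r | P i) f i) = \sum_(i <- r | P i) dot x (f i).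
Proof.
by apply: (big_morph (dot x)) => [y z|]; rewrite ?dotDr ?dot0r.
Qed.

Lemma dot_suml I (r : seq I) (P : pred I) (f : I -> E) x :
  dot (\sum_(i <- r | P i) f i) x = \sum_(i <- r | P i) dot (f i) x.
Proof. by rewrite dotC dot_sumr; apply: eq_bigr => i _; rewrite dotC. Qed.

Lemma dot_ge0 x : 0 <= dot x x.
Proof. by apply: sumr_ge0 => i _; rewrite -expr2 sqr_ge0. Qed.

Lemma dot_eq0 x : (dot x x == 0) = (x == 0).
Proof.
apply/idP/eqP => [|->]; last by rewrite dot0l.
rewrite psumr_eq0 => [/allP h|i _]; last by rewrite -expr2 sqr_ge0.
apply/rowP => i; rewrite mxE; apply/eqP.
by have := h i (mem_index_enum i); rewrite -expr2 sqrf_eq0.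
Qed.

Lemma dot_gt0 x : (0 < dot x x) = (x != 0).
Proof. by rewrite lt_def dot_ge0 andbT dot_eq0. Qed.

Lemma dot_delta x i : dot x (delta_mx 0 i) = x 0 i.
Proof.
rewrite /dot (bigD1 i) //= mxE !eqxx mulr1 big1 ?addr0 // => j ji.
by rewrite mxE (negPf ji) andbF mulr0.
Qed.

Lemma dot_continuous x : continuous (dot x).
Proof.
move=> y; rewrite /dot.
apply: (@cvg_big R^o _ _ _ _ (@add_continuous R^o) E (nbhs y)) => i _.
rewrite /=.
apply: (@cvgM R E (nbhs y) (nbhs_filter y)).
  exact: (@cvg_cst R^o _ E (nbhs y) (nbhs_filter y)).
exact: coord_continuous.
Qed.

(** Helly's theorem on the line, for the half-lines bounded by the given
reals. *)
Lemma seq_between (ls us : seq R) :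
  (forall l u, l \in ls -> u \in us -> l <= u) ->
  exists t, (forall l, l \in ls -> l <= t) /\ (forall u, u \in us -> t <= u).
Proof.
elim: ls => [|l ls IH] h.
  elim: us {h} => [|u us [t [_ ht]]]; first by exists 0.
  exists (Num.min u t); split=> // w; rewrite inE ge_min => /orP[/eqP->|/ht->].
    by rewrite lexx.
  by rewrite orbT.
have [|t [h1 h2]] := IH.
  by move=> l' u l'ls uus; apply: h => //; rewrite inE l'ls orbT.
exists (Num.max l t); split=> [l'|u uus].
  by rewrite inE le_max => /orP[/eqP->|/h1->]; rewrite ?lexx // orbT.
by rewrite ge_max h2 // h // mem_head.
Qed.

(** Elimination of t: each inequality bounds t from below, from above or not
at all, according to the sign of the scalar product of b and w. The solutions
in t form an interval, which is nonempty when every lower bound, 0 included,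
is at most every upper bound; clearing denominators turns these comparisons
into linear inequalities on x. *)
Lemma fourier_motzkin (bs : seq E) w :
  exists bs' : seq E, forall x,
    (exists2 t, 0 <= t & forall b, b \in bs -> 0 <= dot b (x - t *: w)) <->
    (forall b, b \in bs' -> 0 <= dot b x).
Proof.
pose ps := [seq b <- bs | 0 <= dot b w].
pose qs := [seq dot b w *: c - dot c w *: b | b <- [seq b <- bs | 0 < dot b w],
             c <- [seq c <- bs | dot c w < 0]].
exists (ps ++ qs) => x; split=> [[t t0 ht] b|h].
  rewrite mem_cat => /orP[|/allpairsP[[b1 c1] /= [] ]].
    rewrite mem_filter => /andP[bw bbs].
    have := ht b bbs; rewrite dotBr dotZr subr_ge0; apply: le_trans.
    exact: mulr_ge0.
  rewrite !mem_filter => /andP[bw b1s] /andP[cw c1s] ->.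
  have := ht _ b1s; have := ht _ c1s; rewrite !dotBr !dotZr dotBl !dotZl => h1 h2.
  nra.
pose ls := 0 :: [seq dot c x / dot c w | c <- [seq c <- bs | dot c w < 0]].
pose us := [seq dot b x / dot b w | b <- [seq b <- bs | 0 < dot b w]].
have [|t [tl tu]] := @seq_between ls us.
  move=> l u + /mapP[b]; rewrite mem_filter => + /andP[bw bbs] ->.
  rewrite inE => /orP[/eqP->|/mapP[c]].
    apply: divr_ge0; last exact: ltW.
    by apply: h; rewrite mem_cat mem_filter (ltW bw) bbs.
  rewrite mem_filter => /andP[cw cbs] ->.
  have := h (dot b w *: c - dot c w *: b); rewrite mem_cat.
  rewrite [_ \in qs]allpairs_f ?mem_filter ?bw ?cw // orbT => /(_ isT).
  rewrite dotBl !dotZl ler_ndivrMr // mulrAC ler_pdivrMr // => h1.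
  nra.
exists t => [|b bbs]; first by apply: tl; rewrite mem_head.
rewrite dotBr dotZr subr_ge0; case: (ltgtP (dot b w) 0) => bw.
- have : dot b x / dot b w \in ls.
    by rewrite inE; apply/orP; right; apply: map_f; rewrite mem_filter bw.
  by move/tl; rewrite ler_ndivrMr.
- have : dot b x / dot b w \in us by apply: map_f; rewrite mem_filter bw.
  by move/tu; rewrite ler_pdivlMr.
- by rewrite bw mulr0; apply: h; rewrite mem_cat mem_filter bw lexx bbs.
Qed.

(** The generators are added one at a time, each by one Fourier-Motzkin
step. *)
Lemma conic_halfspaces k (g : 'I_k -> E) :
  exists bs : seq E, forall x,
    (exists2 a : 'I_k -> R, (forall i, 0 <= a i) & x = \sum_(i < k) a i *: g i)
    <-> (forall b, b \in bs -> 0 <= dot b x).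
Proof.
elim: k g => [|k IH] g.
  exists (codom (fun i => delta_mx 0 i) ++ codom (fun i => - delta_mx 0 i)).
  move=> x; split=> [[a _ ->] b _|h]; first by rewrite big_ord0 dot0r.
  exists (fun=> 0) => //; rewrite big_ord0; apply/rowP => i; rewrite mxE.
  have := h (delta_mx 0 i); have := h (- delta_mx 0 i).
  rewrite !mem_cat !codom_f orbT => /(_ isT) + /(_ isT).
  by rewrite dotNl !(dotC _ x) dot_delta => ? ?; apply/eqP; lra.
have [bs hbs] := IH (g \o lift ord0).
have [bs' h'] := fourier_motzkin bs (g ord0).
exists bs' => x; rewrite -h'; split=> [[a a0 ->]|[t t0 /hbs[a a0 e]]].
  exists (a ord0) => //; apply/hbs; exists (a \o lift ord0) => //=.
  by rewrite big_ord_recl addrAC subrr add0r.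
exists (fun i => oapp a t (unlift ord0 i)).
  by move=> i; case: unliftP => [j|] _ /=.
rewrite big_ord_recl unlift_none /=.
rewrite (eq_bigr (fun i => a i *: g (lift ord0 i))) => [|i _]; last by rewrite liftK.
by rewrite -e addrC subrK.
Qed.

End Basics.

(** * General position and dimension counts *)

Section Generic.
Context {R : realType} {d : nat}.
Local Notation E := 'rV[R]_d.
Implicit Types (x y z w : E) (A B C D K : set E).

Lemma small_all (T : eqType) (s : seq T) (P : T -> R -> Prop) :
  (forall i, i \in s -> exists2 e, 0 < e & forall t, 0 <= t <= e -> P i t) ->
  exists2 e, 0 < e & forall t, 0 <= t <= e -> forall i, i \in s -> P i t.
Proof.
elim: s => [|i s IH] h; first by exists 1.
have [e1 e10 h1] := h i (mem_head _ _).
have [|e2 e20 h2] := IH; first by move=> j js; apply: h; rewrite inE js orbT.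
exists (Num.min e1 e2); first by rewrite lt_min e10.
move=> t; rewrite le_min => /andP[t0 /andP[t1 t2]] j; rewrite inE.
case/orP=> [/eqP->|]; first by apply: h1; rewrite t0.
by apply: h2; rewrite t0.
Qed.

Definition cvxset A :=
  forall x y t, A x -> A y -> 0 <= t <= 1 -> A (x + t *: (y - x)).

(** A line that is not contained in a subspace meets it in at most one
point. *)
Lemma notin_small (W : {vspace E}) x w : x \notin W ->
  exists2 e, 0 < e & forall t, 0 <= t <= e -> x + t *: w \notin W.
Proof.
move=> xW; have [[t [t0 tW]]|h] := pselect (exists t, 0 < t /\ x + t *: w \in W).
  exists (t / 2); first by rewrite divr_gt0.
  move=> r /andP[r0 rt]; apply/negP => rW; case/negP: xW.
  have tr : t - r != 0 by apply/eqP; lra.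
  have -> : x = (t - r)^-1 *: (t *: (x + r *: w) - r *: (x + t *: w)).
    by apply/rowP => i; rewrite !mxE; field.
  by rewrite memvZ // rpredB // memvZ.
exists 1 => // t /andP[]; rewrite le_eqVlt => /orP[/eqP<-|t0] _.
  by rewrite scale0r addr0.
by apply/negP => tW; apply: h; exists t.
Qed.

(** A convex set is not a finite union of its traces on affine subspaces: if q
avoids the subspaces treated so far and a avoids the next one, then so do all
points of the segment from q to a that are close to q but distinct from it. *)
Lemma convex_avoid A v (ws : seq {vspace E}) : cvxset A -> A !=set0 ->
  (forall W, W \in ws -> exists2 a, A a & a - v \notin W) ->
  exists2 a, A a & forall W, W \in ws -> a - v \notin W.
Proof.
move=> cA [a0 Aa0]; elim: ws => [|W ws IH] h; first by exists a0.
have [|q Aq hq] := IH; first by move=> W' W's; apply: h; rewrite inE W's orbT.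
have [qW|qW] := boolP (q - v \in W); last first.
  by exists q => // W'; rewrite inE => /orP[/eqP->//|]; apply: hq.
have [a Aa aW] := h W (mem_head _ _).
have [e e0 he] := @small_all _ ws (fun W t => (q - v) + t *: (a - q) \notin W)
  (fun W' hW => notin_small (a - q) (hq W' hW)).
pose t := Num.min e 1; have t0 : 0 < t by rewrite lt_min e0 /=.
have te : t <= e by rewrite ge_min lexx.
have t1 : t <= 1 by rewrite ge_min lexx orbT.
exists (q + t *: (a - q)) => [|W']; first by apply: cA; rewrite // (ltW t0).
rewrite addrAC inE => /orP[/eqP->|W's]; last by apply: he; rewrite // (ltW t0).
rewrite rpredDl //; apply: contra aW => tW.
have aq : a - q \in W by rewrite -(scalerK (lt0r_neq0 t0) (a - q)) memvZ.
by rewrite -(subrKA q) rpredD.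
Qed.

Lemma dim_addline (V : {vspace E}) w : w \notin V ->
  \dim (V + <[w]>) = (\dim V).+1.
Proof.
move=> wV; have w0 : w != 0 by apply: contraNneq wV => ->; rewrite mem0v.
rewrite dimv_disjoint_sum ?dim_vline ?w0 ?addn1 //.
apply/eqP; rewrite -subv0; apply/subvP => x /memv_capP[xV /vlineP[k xE]].
rewrite memv0; apply: contraNT wV => x0.
have k0 : k != 0 by apply: contraNneq x0 => k0; rewrite xE k0 scale0r.
by rewrite -(scalerK k0 w) memvZ // -xE.
Qed.

Lemma dim_addline_le (V : {vspace E}) w : (\dim (V + <[w]>) <= (\dim V).+1)%N.
Proof.
have [wV|/dim_addline->//] := boolP (w \in V).
suff -> : (V + <[w]>)%VS = V by [].
by apply/addv_idPl; rewrite -memvE.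
Qed.

Lemma dim_full : \dim {:E} = d.
Proof. by rewrite dimvf /dim /= mul1n. Qed.

Lemma dim_le (V : {vspace E}) : (\dim V <= d)%N.
Proof. by rewrite -[X in (_ <= X)%N]dim_full dimvS // subvf. Qed.

Lemma dim_full_eq (V : {vspace E}) : \dim V = d -> V = fullv.
Proof. by move=> h; apply/eqP; rewrite eqEdim subvf dim_full h leqnn. Qed.

Definition perp (V : {vspace E}) n := forall u, u \in V -> dot n u = 0.

(** The orthogonal complement of a subspace of codimension 1 is a line. *)
Lemma perp_line (V : {vspace E}) n n' : (\dim V + 1)%N = d -> perp V n ->
  perp V n' -> n != 0 -> n' = (dot n' n / dot n n) *: n.
Proof.
move=> dV pn pn' n0; have nn : dot n n != 0 by rewrite dot_eq0.
have nV : n \notin V by apply: contra nn => /pn ->.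
have fV : (V + <[n]>)%VS = fullv.
  by apply: dim_full_eq; rewrite dim_addline // -addn1.
set k := (X in X *: n); apply/eqP; rewrite -subr_eq0 -dot_eq0.
have /memv_addP[u uV [w /vlineP[l ->] e]] : n' - k *: n \in (V + <[n]>)%VS.
  by rewrite fV memvf.
rewrite {2}e dotDr dotZr !dotBl !dotZl pn' // pn // mulfVK // subrr.
by rewrite !mulr0 subrr addr0.
Qed.

End Generic.

(** Linear identities between row vectors, checked on coordinates. *)
Ltac vec := apply/rowP => ?; rewrite ?mxE; (ring || field).

(** * Cones of a complete pointed fan *)

Section FanBasics.
Context {R : realType} {d : nat}.
Local Notation E := 'rV[R]_d.

Lemma line_continuous (x w : E) : continuous (fun t : R => x + t *: w).
Proof.
move=> t; apply: (@cvgD _ E); first exact: cvg_cst.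
by apply: cvgZr_tmp; exact: cvg_id.
Qed.

(** A topological interior point can be moved a little in every direction.
Convexity arguments only use this radial property. *)
Lemma interior_core (A : set E) x w : A° x ->
  exists2 e, 0 < e & forall t, 0 <= t <= e -> A (x + t *: w).
Proof.
move=> Ax; have := @line_continuous x w 0.
rewrite /continuous_at /= scale0r addr0 => /(_ _ Ax) /nbhs_ballP[e /= e0 he].
exists (e / 2); first by rewrite divr_gt0.
move=> t /andP[t0 te]; apply: he; rewrite -ball_normE /= sub0r normrN ger0_norm //.
lra.
Qed.

Lemma direction_uniq (A : set E) U V : direction A U -> direction A V -> U = V.
Proof.
move=> [h1 h2] [h3 h4]; apply/eqP; rewrite eqEsubv; apply/andP.
by split; [apply: h2|apply: h4].
Qed.

Lemma has_dim_direction (A : set E) U m :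
  has_dim A m -> direction A U -> \dim U = m.
Proof. by move=> [_ [V dV <-]] dU; rewrite (direction_uniq dU dV). Qed.

(** The relative interior in the algebraic sense: from z one can move inside K
in every direction of the subspace U, which is meant to be the direction of
K. *)
Definition relint (K : set E) (U : {vspace E}) z :=
  K z /\ forall u, u \in U -> exists2 e, 0 < e & K (z + e *: u).

Definition fan_at (F : set (set E)) (v : E) :=
  [/\ fan F, complete_fan F, F [set v] & forall C, F C -> C v].

Context {F : set (set E)} {v : E} (HF : fan_at F v).
Implicit Types (x y z w u : E) (A B C D K : set E).

Let fanF : fan F. Proof. by case: HF. Qed.
Let covF : complete_fan F. Proof. by case: HF. Qed.

Lemma mem_vertex C : F C -> C v. Proof. by case: HF => _ _ _; apply. Qed.
Lemma vertex_mem : F [set v]. Proof. by case: HF. Qed.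

Lemma fan_seq : exists fs : seq (set E), forall C, F C <-> C \in fs.
Proof.
case: fanF => /finite_seqP[fs ->] _ _ _; exists fs => C.
by split.
Qed.

Lemma mem_cap C D : F C -> F D -> F (C `&` D).
Proof.
move=> FC FD; case: fanF => _ _ h1 h2.
by have [h3 h4 _] := h2 _ _ FC FD; apply: h1 h4 h3.
Qed.

Lemma cap_face C D : F C -> F D -> face C (C `&` D).
Proof. by move=> FC FD; case: fanF => _ _ _ h; have [] := h _ _ FC FD. Qed.

(** The apex p of a member of the fan is its vertex v: otherwise v is the
midpoint of p and 2v - p, both in the cone, whereas the singleton of v is a
face of it. *)
Lemma mem_gen C : F C -> exists (k : nat) (g : 'I_k -> E),
  C = [set x | exists2 a : 'I_k -> R,
        (forall i, 0 <= a i) & x = v + \sum_(i < k) a i *: g i].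
Proof.
move=> FC; case: (fanF) => _ /(_ _ FC)[p [k [g Cg]]] _ _.
suff <- : p = v by exists k, g.
have [c [b [cb e]]] := cap_face FC vertex_mem.
have Cv := mem_vertex FC.
have ev : dot c v = b.
  have : (C `&` [set v]) v by [].
  by rewrite e => -[].
have Cp : C p.
  rewrite Cg; exists (fun=> 0) => //.
  by rewrite big1 ?addr0 // => i _; rewrite scale0r.
have Cq : C (v + v - p).
  move: Cv; rewrite Cg => -[a a0 ->]; exists (fun i => a i + a i).
    by move=> i; rewrite addr_ge0.
  under [in RHS]eq_bigr do rewrite /= scalerDl.
  by rewrite big_split /=; set S := \sum_(i < k) _; vec.
have pb : dot c p = b.
  by have := cb _ Cp; have := cb _ Cq; rewrite dotBr dotDr ev => *; lra.
by have : (C `&` [set v]) p; [rewrite e | case].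
Qed.

Lemma mem_half C : F C ->
  exists bs : seq E, forall x, C x <-> forall b, b \in bs -> 0 <= dot b (x - v).
Proof.
move=> /mem_gen[k [g ->]]; have [bs hbs] := conic_halfspaces g.
exists bs => x; rewrite -hbs; split=> -[a a0 e]; exists a => //.
  by rewrite e addrC addKr.
by rewrite -e addrC subrK.
Qed.

Lemma mem_cvx C : F C -> cvxset C.
Proof.
move=> /mem_half[bs h] x y t /h hx /h hy /andP[t0 t1]; apply/h => b bbs.
have -> : x + t *: (y - x) - v = (1 - t) *: (x - v) + t *: (y - v) by vec.
by rewrite dotDr !dotZr addr_ge0 // mulr_ge0 ?hx ?hy // subr_ge0.
Qed.

Lemma mem_scale C x t : F C -> C x -> 0 <= t -> C (v + t *: (x - v)).
Proof.
move=> /mem_half[bs h] /h hx t0; apply/h => b bbs.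
by rewrite addrC addKr dotZr mulr_ge0 // hx.
Qed.

Lemma mem_add C x y : F C -> C x -> C y -> C (x + (y - v)).
Proof.
move=> /mem_half[bs h] /h hx /h hy; apply/h => b bbs.
by rewrite addrAC dotDr addr_ge0 ?hx ?hy.
Qed.

Lemma mem_near C y : F C -> ~ C y -> \forall y' \near y, ~ C y'.
Proof.
move=> /mem_half[bs h] Cy.
have [b bbs by0] : exists2 b, b \in bs & dot b (y - v) < 0.
  apply: contrapT => hn; apply: Cy; apply/h => b bbs; rewrite leNgt.
  by apply/negP => hb; apply: hn; exists b.
have : \forall y' \near y, dot b y' < dot b v.
  have h' : dot b y < dot b v by rewrite -subr_lt0 -dotBr.
  exact: (@dot_continuous _ _ b y _ (lt_nbhsl h')).
apply: filterS => y' hy' /h /(_ b bbs).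
by rewrite dotBr leNgt subr_lt0 hy'.
Qed.

(** The members of the fan are closed and finite in number. *)
Lemma fan_near y : \forall y' \near y, forall C, F C -> C y' -> C y.
Proof.
have [fs hfs] := fan_seq.
suff : \forall y' \near y, forall C, C \in fs -> C y' -> C y.
  by apply: filterS => y' h C /hfs; exact: h.
have : forall C, C \in fs -> F C by move=> C /hfs.
elim: {hfs} fs => [|C fs IH] hfs; first by near=> y'.
have : \forall y' \near y, C y' -> C y.
  have [Cy|Cy] := pselect (C y); first by near=> y'.
  have := mem_near (hfs C (mem_head _ _)) Cy.
  by apply: filterS => y' h /h.
have : \forall y' \near y, forall C, C \in fs -> C y' -> C y.
  by apply: IH => D Dfs; apply: hfs; rewrite inE Dfs orbT.
apply: filterS2 => y' h1 h2 D; rewrite inE => /orP[/eqP->//|]; exact: h1.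
Unshelve. all: by end_near.
Qed.

(** The generators of the cone span its direction, and their sum, taken from
v, is a relative interior point: its coordinates are all 1, and a small change
keeps them nonnegative. *)
Lemma mem_dir C : F C -> exists U z, direction C U /\ relint C U z.
Proof.
move=> /mem_gen[k [g ->]].
pose gt := [tuple g i | i < k].
have gtE (i : 'I_k) : gt`_i = g i by rewrite -tnth_nth tnth_mktuple.
have gin i : g i \in <<gt>>%VS by apply: memv_span; rewrite -gtE mem_nth ?size_tuple.
exists <<gt>>%VS, (v + \sum_(i < k) g i); split; first split.
- move=> x y [a a0 ->] [b b0 ->].
  rewrite opprD addrACA subrr add0r -sumrB memv_suml // => i _.
  by rewrite -scalerBl memvZ.
- move=> W hW; apply/span_subvP => w /tnthP[i ->]; rewrite tnth_mktuple.
  have -> : g i = (v + g i) - v by rewrite addrC addKr.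
  apply: hW.
    exists (fun=> 0) => //.
    by rewrite big1 ?addr0 // => j _; rewrite scale0r.
  exists (fun j => (j == i)%:R) => [j|]; first by rewrite ler0n.
  rewrite (bigD1 i) //= eqxx scale1r big1 ?addr0 // => j /negPf->.
  by rewrite scale0r.
split=> [|u uU].
  by exists (fun=> 1) => //; congr (v + _); apply: eq_bigr => i _; rewrite scale1r.
have uE := coord_span uU.
pose c i := coord gt i u; pose s := 1 + \sum_(i < k) `|c i|.
have s0 : 0 < s by rewrite ltr_pwDl // sumr_ge0.
exists s^-1; first by rewrite invr_gt0.
exists (fun i => 1 + s^-1 * c i) => [i|].
  have : `|s^-1 * c i| <= 1.
    rewrite normrM gtr0_norm ?invr_gt0 // mulrC ler_pdivrMr // mul1r /s.
    by rewrite (bigD1 i) //= addrCA lerDl addr_ge0 // sumr_ge0.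
  by rewrite ler_norml => /andP[]; lra.
under [in RHS]eq_bigr do rewrite scalerDl scale1r -scalerA.
rewrite big_split /= addrA -scaler_sumr; congr (_ + _ *: _).
by rewrite [LHS]uE; apply: eq_bigr => i _; rewrite gtE.
Qed.

(** A linear form that is maximal on K at a relative interior point of K is
constant on K; hence the face which C cuts out of K is K itself. *)
Lemma relint_sub C K U z : F C -> F K -> direction K U -> relint K U z ->
  C z -> K `<=` C.
Proof.
move=> FC FK [dU _] [Kz rK] Cz x Kx.
have [c [b [cb e]]] := cap_face FK FC.
have zb : dot c z = b by have : (K `&` C) z by []; rewrite e => -[].
have [t t0 /cb] := rK (z - x) (dU _ _ Kx Kz).
rewrite dotDr dotZr zb dotBr zb gerDl pmulr_rle0 // subr_le0 => bx.
suff : (K `&` C) x by case.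
by rewrite e; split=> //=; apply: le_anti; rewrite bx cb.
Qed.

Lemma cellP C : cell F C <-> F C /\ direction C fullv.
Proof.
split=> [[FC [m hm]]|[FC dC]].
  rewrite addn0 => md; split=> //; case: hm => _ [U dU].
  by rewrite md => /dim_full_eq <-.
split=> //; exists d; last by rewrite addn0.
split; first by exists v; exact: mem_vertex.
by exists fullv; rewrite ?dim_full.
Qed.

Lemma codim_dir C c U : codim_face F c C -> direction C U -> (\dim U + c)%N = d.
Proof. by move=> [FC [m hm md]] /(has_dim_direction hm) ->. Qed.

Lemma dir_codim C c U : F C -> direction C U -> (\dim U + c)%N = d ->
  codim_face F c C.
Proof.
move=> FC dU h; split=> //; exists (\dim U) => //; split; last by exists U.
by exists v; exact: mem_vertex.
Qed.

(** In the description by half-spaces, a point from which one can move in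
every direction satisfies each nontrivial inequality strictly. *)
Lemma core_interior C x : F C ->
  (forall w, exists2 e, 0 < e & C (x + e *: w)) -> C° x.
Proof.
move=> /mem_half[bs h] hx; rewrite /interior /=.
suff : \forall y \near x, forall b, b \in bs -> 0 <= dot b (y - v).
  by apply: filterS => y /h.
have : forall b, b \in bs -> \forall y \near x, 0 <= dot b (y - v).
  move=> b bbs; have [->|b0] := eqVneq b 0.
    by near=> y; rewrite dot0l.
  have [e e0 /h/(_ b bbs)] := hx (- b).
  rewrite -addrAC dotDr dotZr dotNr mulrN subr_ge0 => hb.
  have bx : 0 < dot b (x - v) by apply: lt_le_trans hb; rewrite mulr_gt0 // dot_gt0.
  have : \forall y \near x, dot b v < dot b y.
    have h' : dot b v < dot b x by rewrite -subr_gt0 -dotBr.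
    exact: (@dot_continuous _ _ b x _ (lt_nbhsr h')).
  by apply: filterS => y hy; rewrite dotBr subr_ge0 ltW.
elim: bs {h hx} => [|b bs IH] h; first by near=> y.
have h1 := h b (mem_head _ _).
have : \forall y \near x, forall b, b \in bs -> 0 <= dot b (y - v).
  by apply: IH => c cbs; apply: h; rewrite inE cbs orbT.
move: h1; apply: filterS2 => y h1 h2 c.
by rewrite inE => /orP[/eqP->//|]; exact: h2.
Unshelve. all: by end_near.
Qed.

Lemma cell_interior C : cell F C -> exists x, C° x.
Proof.
move=> /cellP[FC dC]; have [U [z [dU [Cz rz]]]] := mem_dir FC.
exists z; apply: core_interior => // w; apply: rz.
by rewrite (direction_uniq dU dC) memvf.
Qed.

Lemma interior_mem C x : C° x -> C x.
Proof. exact: nbhs_singleton. Qed.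

Lemma core_perp0 C x c b : C° x -> (forall y, C y -> dot c y <= b) ->
  dot c x = b -> c = 0.
Proof.
move=> Cx cb xb; have [e e0 /(_ e)] := interior_core c Cx.
rewrite lexx (ltW e0) => /(_ isT) /cb.
rewrite dotDr dotZr xb gerDl pmulr_rle0 // leNgt => h.
by apply/eqP; apply: contraNT h; rewrite dot_gt0.
Qed.

(** The intersection of C and D is a face of both. It contains an interior
point of C, so the linear forms that define it vanish and it equals C and
D. *)
Lemma cell_inj C D x : F C -> F D -> C° x -> D x -> C = D.
Proof.
move=> FC FD Cx Dx; have Cx' := interior_mem Cx.
have [c [b [cb e]]] := cap_face FC FD.
have xb : dot c x = b by have : (C `&` D) x by []; rewrite e => -[].
have c0 := core_perp0 Cx cb xb.
have CD : C `&` D = C.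
  by rewrite e c0 -xb c0; apply/seteqP; split=> [y []|y Cy] //; split=> //=; rewrite !dot0l.
have [c' [b' [cb' e']]] := cap_face FD FC.
move: e'; rewrite setIC CD => e'.
have xb' : dot c' x = b' by move: Cx'; rewrite e' => -[].
have c0' : c' = 0.
  apply: (core_perp0 Cx _ xb') => y; rewrite e' => -[Dy _]; exact: cb'.
rewrite e' c0' -xb' c0'; apply/seteqP; split=> [y []|y Dy] //.
by split=> //=; rewrite !dot0l.
Qed.

Lemma interior_mix C z x t : F C -> C z -> C° x -> 0 < t <= 1 ->
  C° (z + t *: (x - z)).
Proof.
move=> FC Cz Cx /andP[t0 t1]; apply: core_interior => // w.
have [e e0 /(_ e)] := interior_core w Cx; rewrite lexx (ltW e0) => /(_ isT) Cw.
exists (t * e); first exact: mulr_gt0.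
have -> : z + t *: (x - z) + (t * e) *: w = z + t *: ((x + e *: w) - z) by vec.
by apply: mem_cvx; rewrite // t1 ltW.
Qed.

(** The projection of a cell along the affine hull of one of its faces K maps
interior points to interior points of the tangent cone at z. The point that
moves is the mixture of x with a point of K that compensates the component u
along K. *)
Lemma interior_shift C K U z x w : F C -> F K -> relint K U z ->
  K `<=` C -> C° x -> x - z - w \in U ->
  exists2 e, 0 < e & forall t, 0 < t <= e -> C° (z + t *: w).
Proof.
move=> FC FK [Kz rK] KC Cx; set u := x - z - w => uU.
have [|e e0 Ku] := rK (- u); first by rewrite memvN.
have e1 : 1 + e != 0 by apply/eqP; lra.
(* with this weight, the point z + e (- u) of K and x combine to a point of
   the line z + t w *)
pose e' := e / (1 + e); have e'0 : 0 < e' by rewrite divr_gt0 //; lra.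
have e'1 : e' <= 1 by rewrite ler_pdivrMr; lra.
have Ce' : C° (z + e' *: w).
  have -> : z + e' *: w = (z + e *: - u) + e' *: (x - (z + e *: - u)).
    by rewrite /u /e'; vec.
  by apply: interior_mix; rewrite ?e'0 //; exact: KC.
exists e' => // t /andP[t0 te].
have -> : z + t *: w = z + (t / e') *: (z + e' *: w - z).
  by rewrite addrAC subrr add0r scalerA divfK ?lt0r_neq0.
apply: interior_mix => //; first exact: KC.
by rewrite divr_gt0 //= ler_pdivrMr // mul1r.
Qed.

(** Otherwise a ball around x would be covered by finitely many members of
smaller dimension, against general position. *)
Lemma cells_cover x : exists C, cell F C /\ C x.
Proof.
apply: contrapT => hn.
have [fs hfs] := fan_seq.
have [e e0 he] : exists2 e : R, 0 < e & forall y, ball x e y ->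
    forall C, F C -> C y -> C x.
  by have /nbhs_ballP[e /= e0 he] := fan_near x; exists e => // y /he.
have [dirf hdir] : {f : set E -> {vspace E} & forall C, F C -> direction C (f C)}.
  have /choice[f hf] : forall C, exists U, F C -> direction C U.
    move=> C; have [FC|] := pselect (F C); last by exists fullv.
    by have [U [z [dU _]]] := mem_dir FC; exists U.
  by exists f.
pose ncells := [seq C <- fs | `[< ~ cell F C >]].
have [|||a ab ha] := @convex_avoid _ _ (ball x e) v (map dirf ncells).
- move=> y z t; rewrite -!ball_normE /= => hy hz /andP[t0 t1].
  have -> : x - (y + t *: (z - y)) = (1 - t) *: (x - y) + t *: (x - z) by vec.
  apply: le_lt_trans (ler_normD _ _) _; rewrite !normrZ.
  rewrite (ger0_norm t0) ger0_norm ?subr_ge0 //.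
  move: hy hz; set p := `|_|; set q := `|_| => hy hz.
  have [->|t1'] := eqVneq t 1; first by rewrite subrr mul0r add0r mul1r.
  have t2 : 0 < 1 - t by rewrite subr_gt0 lt_neqAle t1'.
  have h1 : (1 - t) * p < (1 - t) * e by rewrite ltr_pM2l.
  have h2 : t * q <= t * e by rewrite ler_wpM2l // ltW.
  lra.
- by exists x; exact: ballxx.
- move=> W /mapP[C]; rewrite mem_filter => /andP[/asboolP nC /hfs FC] ->.
  apply: contrapT => h.
  have hh y : ball x e y -> y - v \in dirf C.
    by move=> bxy; apply/negPn/negP => hy; apply: h; exists y.
  apply: nC; apply/cellP; split=> //.
  suff <- : dirf C = fullv by exact: hdir.
  apply/eqP; rewrite eqEsubv subvf; apply/subvP => w _.
  have bx : (ball x e)° x by exact: nbhsx_ballx.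
  have [r r0 /(_ r)] := interior_core w bx.
  rewrite lexx (ltW r0) => /(_ isT) /hh h1.
  have h2 := hh _ (ballxx x e0).
  rewrite -(scalerK (lt0r_neq0 r0) w) memvZ //.
  have -> : r *: w = (x + r *: w - v) - (x - v) by vec.
  exact: rpredB.
have : setT a by []; rewrite -covF => -[C FC Ca].
have [cC|nC] := pselect (cell F C).
  by apply: hn; exists C; split=> //; exact: (he a).
have /ha : dirf C \in map dirf ncells.
  by rewrite map_f // mem_filter; apply/andP; split; [exact/asboolP|exact/hfs].
by rewrite (hdir _ FC).1 //; exact: mem_vertex.
Qed.

(** The intersection of all the members that contain z. *)
Lemma minface z : exists K, [/\ F K, K z & forall A, F A -> A z -> K `<=` A].
Proof.
have [fs hfs] := fan_seq.
suff [K [FK Kz h]] : exists K, [/\ F K, K z & forall A, A \in fs -> A z -> K `<=` A].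
  by exists K; split=> // A /hfs; exact: h.
have : forall A, A \in fs -> F A by move=> A /hfs.
elim: {hfs} fs => [|A fs IH] h.
  by have [C [[FC _] Cz]] := cells_cover z; exists C; split.
have [|K [FK Kz hK]] := IH; first by move=> D Ds; apply: h; rewrite inE Ds orbT.
have [Az|Az] := pselect (A z); last first.
  by exists K; split=> // D; rewrite inE => /orP[/eqP->//|]; exact: hK.
exists (A `&` K); split=> //; first by apply: mem_cap => //; apply: h; exact: mem_head.
move=> D; rewrite inE => /orP[/eqP-> _ y []//|Ds Dz].
by move=> y [_]; exact: hK.
Qed.

End FanBasics.

(** * Adjacent cells and unit normals *)

Section Adjacency.
Context {R : realType} {d : nat}.
Local Notation E := 'rV[R]_d.
Context {F : set (set E)} {v : E} (HF : fan_at F v).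
Implicit Types (x y z w u n : E) (A B C D K H : set E).

Lemma relint_perp K U z c b : relint K U z -> (forall x, K x -> dot c x = b) ->
  perp U c.
Proof.
move=> [Kz rK] cb u uU; have [e e0 /cb] := rK u uU.
rewrite dotDr dotZr (cb z Kz) -[RHS]addr0 => /addrI/eqP.
by rewrite mulf_eq0 (gt_eqF e0) /= => /eqP.
Qed.

Lemma perp_decomp (V : {vspace E}) n w : (\dim V + 1)%N = d -> perp V n ->
  n != 0 -> w - (dot n w / dot n n) *: n \in V.
Proof.
move=> dV pn n0; have nn : dot n n != 0 by rewrite dot_eq0.
have nV : n \notin V by apply: contra nn => /pn ->.
have fV : (V + <[n]>)%VS = fullv.
  by apply: dim_full_eq; rewrite dim_addline // -addn1.
have /memv_addP[u uV [w' /vlineP[l ->] ->]] : w \in (V + <[n]>)%VS.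
  by rewrite fV memvf.
by rewrite dotDr (pn _ uV) add0r dotZr mulfK // addrK.
Qed.

Lemma interior_neg C x n z : C° x -> (forall y, C y -> dot n (y - z) <= 0) ->
  n != 0 -> dot n (x - z) < 0.
Proof.
move=> Cx h n0; rewrite lt_neqAle h ?andbT; last exact: interior_mem.
apply: contra n0 => /eqP nx; apply/eqP; apply: (core_perp0 Cx (b := dot n z)).
  by move=> y /h; rewrite dotBr subr_le0.
by apply/eqP; rewrite -subr_eq0 -dotBr nx.
Qed.

(** Two cells on the same side of a common hyperface both have interior points
on the normal through the relative interior point z, arbitrarily close to
z. *)
Lemma side_eq H U z D D' x x' n : F H -> (\dim U + 1)%N = d -> relint H U z ->
  F D -> F D' -> H `<=` D -> H `<=` D' -> D° x -> D'° x' -> perp U n ->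
  0 < dot n (x - z) -> 0 < dot n (x' - z) -> D = D'.
Proof.
move=> FH dU rz FD FD' HD HD' Dx Dx' pn nx nx'.
have n0 : n != 0 by apply: contraTneq nx => ->; rewrite dot0l ltxx.
have nn : 0 < dot n n by rewrite dot_gt0.
have [e e0 he] := interior_shift HF FD FH rz HD Dx (perp_decomp (x - z) dU pn n0).
have [e' e'0 he'] :=
  interior_shift HF FD' FH rz HD' Dx' (perp_decomp (x' - z) dU pn n0).
set r := dot n (x - z) / _ in he; set r' := dot n (x' - z) / _ in he'.
have r0 : 0 < r by rewrite divr_gt0.
have r'0 : 0 < r' by rewrite divr_gt0.
pose t := Num.min (e * r) (e' * r').
have t0 : 0 < t by rewrite lt_min; apply/andP; split; exact: mulr_gt0.
have h1 : D° (z + t *: n).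
  have -> : t *: n = (t / r) *: (r *: n) by rewrite scalerA divfK ?lt0r_neq0.
  by apply: he; rewrite divr_gt0 //= ler_pdivrMr // ge_min lexx.
have h2 : D'° (z + t *: n).
  have -> : t *: n = (t / r') *: (r' *: n) by rewrite scalerA divfK ?lt0r_neq0.
  by apply: he'; rewrite divr_gt0 //= ler_pdivrMr // ge_min lexx orbT.
by apply: (cell_inj HF FD FD' h1); apply: interior_mem.
Qed.

(** If the intersection had an interior point, the two cells would be
equal. *)
Lemma cap_dim C D V : cell F C -> cell F D -> C <> D -> direction (C `&` D) V ->
  (\dim V < d)%N.
Proof.
move=> cC cD CD dV; rewrite ltn_neqAle dim_le andbT; apply/eqP => /dim_full_eq Vf.
have FCD := mem_cap HF cC.1 cD.1.
have : cell F (C `&` D) by apply/(cellP HF); split=> //; rewrite -Vf.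
move=> /(cell_interior HF)[x]; rewrite interiorI => -[Cx Dx].
by apply: CD; apply: (cell_inj HF cC.1 cD.1 Cx); apply: interior_mem.
Qed.

Lemma direction_sub K A U V : K `<=` A -> direction K U -> direction A V ->
  (U <= V)%VS.
Proof. by move=> KA [_ h] [h' _]; apply: h => x y /KA Ax /KA Ay; apply: h'. Qed.

(** A proper face lies in a hyperplane that does not contain the whole
cone. *)
Lemma face_eq_dim K A U : F K -> F A -> K `<=` A -> direction K U ->
  direction A U -> A = K.
Proof.
move=> FK FA KA dK dA; have [c [b [cb e]]] := cap_face HF FA FK.
have AK : A `&` K = K by apply/setIidPr.
rewrite AK in e; have [U' [z [dU' rz]]] := mem_dir HF FK.
rewrite (direction_uniq dU' dK) in rz.
have kb x : K x -> dot c x = b by rewrite e => -[].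
have pU := relint_perp rz kb.
apply/seteqP; split=> // x Ax; rewrite e; split=> //=.
have /pU : x - z \in U by apply: dA.1 => //; apply: KA; exact: rz.1.
by rewrite dotBr (kb z rz.1) => /eqP; rewrite subr_eq0 => /eqP.
Qed.

Definition adj C D := [/\ cell F C, cell F D, C <> D & hyperface F (C `&` D)].

Lemma adj_sym C D : adj C D -> adj D C.
Proof. by move=> [h1 h2 h3 h4]; split=> //; [exact/nesym|rewrite setIC]. Qed.

Lemma adj_sup C D K : cell F C -> cell F D -> C <> D -> hyperface F K ->
  K `<=` C -> K `<=` D -> adj C D /\ C `&` D = K.
Proof.
move=> cC cD CD hK KC KD; have [U [z [dU rz]]] := mem_dir HF hK.1.
have FCD := mem_cap HF cC.1 cD.1.
have KCD : K `<=` C `&` D by rewrite subsetI.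
have [V [z' [dV rz']]] := mem_dir HF FCD.
have UV : U = V.
  apply/eqP; rewrite eqEdim (direction_sub KCD dU dV) /=.
  by have := cap_dim cC cD CD dV; have := codim_dir hK dU; lia.
have e : C `&` D = K by apply: (face_eq_dim hK.1 FCD KCD dU); rewrite UV.
by split=> //; split=> //; rewrite e.
Qed.

Lemma unit_normalN H C D n : unit_normal H C D n -> unit_normal H D C (- n).
Proof.
move=> [h1 h2 h3 h4]; split=> [|x y Hx Hy|x y Hx Dy|x y Hx Cy].
- by rewrite dotNl dotNr opprK.
- by rewrite dotNl h2 ?oppr0.
- by rewrite dotNl oppr_le0 h4.
- by rewrite dotNl oppr_ge0 h3.
Qed.

Lemma unit_normal_neq0 H C D n : unit_normal H C D n -> n != 0.
Proof. by case=> h _ _ _; rewrite -dot_eq0 h oner_eq0. Qed.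

Lemma unit_normal_perp H U z C D n : relint H U z -> unit_normal H C D n ->
  perp U n.
Proof.
move=> rz [_ h _ _]; apply: (relint_perp rz (b := dot n z)) => x Hx.
by apply/eqP; rewrite -subr_eq0 -dotBr h //; exact: rz.1.
Qed.

(** The hyperface is cut out of C and of D by linear forms c and c', which are
proportional as both are orthogonal to a hyperplane. The ratio is negative,
since the two cells are not on the same side. *)
Lemma adj_normal C D : adj C D -> exists n, unit_normal (C `&` D) C D n.
Proof.
move=> [cC cD CD hH]; set H := C `&` D in hH *.
have FC := cC.1; have FD := cD.1.
have [U [z [dU rz]]] := mem_dir HF hH.1.
have dimU := codim_dir hH dU.
have [c [b [cb e]]] := cap_face HF FC FD.
have [c' [b' [cb' e']]] := cap_face HF FD FC.
rewrite setIC in e'.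
have hb x : H x -> dot c x = b by rewrite /H e => -[].
have hb' x : H x -> dot c' x = b' by rewrite /H e' => -[].
have pc := relint_perp rz hb; have pc' := relint_perp rz hb'.
have Hz : H z := rz.1; have [Cz Dz] := Hz.
have [x Cx] := cell_interior HF cC; have [y Dy] := cell_interior HF cD.
have c0 : c != 0.
  apply/eqP => c0; apply: CD; apply: (cell_inj HF FC FD Cx).
  have : (C `&` D) x by rewrite e; split=> /=; [exact: interior_mem|rewrite -(hb z Hz) c0 !dot0l].
  by case.
have c'0 : c' != 0.
  apply/eqP => c'0; apply: CD; apply/esym; apply: (cell_inj HF FD FC Dy).
  have : (C `&` D) y by rewrite e'; split=> /=; [exact: interior_mem|rewrite -(hb' z Hz) c'0 !dot0l].
  by case.
have cx : dot c (x - z) < 0.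
  by apply: (interior_neg Cx) => // w /cb; rewrite dotBr (hb z Hz) subr_le0.
have cy : dot c' (y - z) < 0.
  by apply: (interior_neg Dy) => // w /cb'; rewrite dotBr (hb' z Hz) subr_le0.
have c'E := perp_line dimU pc pc' c0.
set l := (X in X *: c) in c'E.
have l0 : l < 0.
  rewrite lt_neqAle; apply/andP; split.
    by apply: contraNneq c'0 => l0; rewrite c'E l0 scale0r.
  rewrite leNgt; apply/negP => l0; apply: CD.
  apply: (side_eq hH.1 dimU rz FC FD _ _ Cx Dy (n := - c)).
  - by move=> w [].
  - by move=> w [].
  - by move=> u uU; rewrite dotNl pc ?oppr0.
  - by rewrite dotNl oppr_gt0.
  - by move: cy; rewrite c'E dotZl dotNl oppr_gt0 pmulr_rlt0.
pose r := (Num.sqrt (dot c c))^-1.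
have r0 : 0 < r by rewrite invr_gt0 sqrtr_gt0 dot_gt0.
exists (r *: c); split=> [|p q Hp Hq|p q Hp Cq|p q Hp Dq].
- rewrite dotZl dotZr mulrA -expr2 exprVn sqr_sqrtr ?dot_ge0 // mulVf //.
  by rewrite dot_eq0.
- by rewrite dotZl dotBr !hb // subrr mulr0.
- by rewrite dotZl pmulr_rle0 // dotBr (hb p Hp) subr_le0 cb.
- rewrite dotZl pmulr_rge0 // -(nmulr_rle0 _ l0) -dotZl -c'E dotBr (hb' p Hp).
  by rewrite subr_le0 cb'.
Qed.

Lemma unit_normal_neg C D H n x z : unit_normal H C D n -> C° x -> H z ->
  dot n (x - z) < 0.
Proof.
move=> un Cx Hz; apply: (interior_neg Cx); last exact: unit_normal_neq0 un.
by case: un => _ _ h _ y Cy; exact: h.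
Qed.

Lemma unit_normal_pos C D H n x z : unit_normal H C D n -> D° x -> H z ->
  0 < dot n (x - z).
Proof.
by move=> /unit_normalN un Dx Hz; have := unit_normal_neg un Dx Hz; rewrite dotNl oppr_lt0.
Qed.

(** The cell C alone determines which of the two opposite unit vectors is the
normal. *)
Lemma normal_prop C D D' H n n' : cell F C -> hyperface F H ->
  unit_normal H C D n -> unit_normal H C D' n' -> n' = n.
Proof.
move=> cC hH un un'; have [U [z [dU rz]]] := mem_dir HF hH.1.
have [x Cx] := cell_interior HF cC.
have n0 := unit_normal_neq0 un.
have := perp_line (codim_dir hH dU) (unit_normal_perp rz un)
  (unit_normal_perp rz un') n0.
set l := (X in X *: n) => n'E.
have h1 := unit_normal_neg un Cx rz.1; have h2 := unit_normal_neg un' Cx rz.1.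
have [nn _ _ _] := un; have [nn' _ _ _] := un'.
rewrite n'E dotZl in h2; have l0 : 0 < l by rewrite -(nmulr_llt0 _ h1).
suff l1 : l = 1 by rewrite n'E l1 scale1r.
move: nn'; rewrite n'E dotZl dotZr nn mulr1 -expr2 => /eqP.
by rewrite sqrf_eq1 => /orP[/eqP//|/eqP l1]; move: l0; rewrite l1 ltr0N1.
Qed.

(** A hyperface has two sides, with at most one cell on each. *)
Lemma two_cells C D D' H : hyperface F H -> cell F C -> cell F D -> cell F D' ->
  H `<=` C -> H `<=` D -> H `<=` D' -> C <> D -> C <> D' -> D = D'.
Proof.
move=> hH cC cD cD' HC HD HD' CD CD'.
have [aCD eH] := adj_sup cC cD CD hH HC HD.
have [aCD' eH'] := adj_sup cC cD' CD' hH HC HD'.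
have [n] := adj_normal aCD; have [n'] := adj_normal aCD'.
rewrite eH eH' => un' un.
have nE := normal_prop cC hH un un'; rewrite nE in un'.
have [U [z [dU rz]]] := mem_dir HF hH.1.
have [x Dx] := cell_interior HF cD; have [x' Dx'] := cell_interior HF cD'.
apply: (side_eq hH.1 (codim_dir hH dU) rz cD.1 cD'.1 HD HD' Dx Dx'
  (unit_normal_perp rz un)).
  exact: unit_normal_pos un Dx rz.1.
exact: unit_normal_pos un' Dx' rz.1.
Qed.

End Adjacency.
Arguments adj {R d} F C D.

(** * Angles and cyclic order *)

Section Angles.
Context {R : realType}.
Implicit Types (a b x y t : R).

Lemma sin_periodz x (m : int) : sin (x + 2 * pi * m%:~R) = sin x.
Proof.
have p n y : sin (y + 2 * pi * n%:R) = sin y.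
  have -> : 2 * pi * n%:R = pi *+ 2 *+ n :> R by rewrite mulr_natr mulr_natl.
  exact: (periodicn (@sinD2pi R)).
case: m => n; first exact: p.
rewrite NegzE rmorphN /= -(p n.+1) -pmulrn mulrN subrK.
by [].
Qed.

Lemma cos_periodz x (m : int) : cos (x + 2 * pi * m%:~R) = cos x.
Proof. by rewrite -!sinDpihalf addrAC sin_periodz. Qed.

(** Reduction of x modulo a full turn to the interval from 0 to twice pi. *)
Lemma sin_pos_angle x : 0 < sin x -> exists m : int, 0 < x + 2 * pi * m%:~R < pi.
Proof.
move=> sx; have p0 := @pi_gt0 R.
pose m := Num.floor (x / (2 * pi)).
have := floor_itv (x / (2 * pi)); rewrite -/m => /andP[].
rewrite ler_pdivlMr ?mulr_gt0 // ltr_pdivrMr ?mulr_gt0 // => h1 h2.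
exists (- m); have : 0 < sin (x + 2 * pi * (- m)%:~R) by rewrite sin_periodz.
rewrite rmorphN /= in h2 *; rewrite intrD mulrDl mul1r in h2.
set y := x + _ => sy.
have y0 : 0 <= y by rewrite /y; lra.
have y2 : y < 2 * pi by rewrite /y; lra.
apply/andP; split; rewrite ltNge; apply/negP => hy.
  by move: sy; rewrite (le_anti (_ : y <= 0 <= y)) ?hy // sin0 ltxx.
have : 0 <= sin (y - pi) by apply: sin_ge0_pi; apply/andP; split; lra.
have -> : sin (y - pi) = - sin y by rewrite -[in RHS](subrK pi y) sinDpi opprK.
lra.
Qed.

Lemma sin_neg_angle x : sin x < 0 -> exists m : int, - pi < x + 2 * pi * m%:~R < 0.
Proof.
rewrite -oppr_gt0 -sinN => /sin_pos_angle[m /andP[h1 h2]]; exists (- m).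
by rewrite rmorphN /=; apply/andP; split; lra.
Qed.

Lemma polar a b : (a, b) != (0, 0) -> exists r t, [/\ 0 < r, 0 <= t < 2 * pi,
  a = r * cos t & b = r * sin t].
Proof.
move=> ab; have p0 := @pi_gt0 R.
pose s := a ^+ 2 + b ^+ 2; have s0 : 0 < s.
  rewrite lt_def addr_ge0 ?sqr_ge0 // andbT paddr_eq0 ?sqr_ge0 // !sqrf_eq0.
  by move: ab; rewrite xpair_eqE.
pose r := Num.sqrt s; have r0 : 0 < r by rewrite sqrtr_gt0.
have r2 : r ^+ 2 = s by rewrite sqr_sqrtr // ltW.
pose c := a / r.
have ra : a = r * c by rewrite /c mulrC divfK // lt0r_neq0.
have c2 : 1 - c ^+ 2 = (b / r) ^+ 2.
  rewrite /c !expr_div_n r2 -{1}(divff (lt0r_neq0 s0)) -mulrBl; congr (_ / _).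
  by rewrite /s; ring.
have c1 : -1 <= c <= 1.
  rewrite -ler_norml -(@ler_pXn2r _ 2) ?nnegrE //.
  by rewrite expr1n real_normK ?num_real // -subr_ge0 c2 sqr_ge0.
have [b0|b0] := leP 0 b.
  exists r, (acos c); split=> //.
  - by rewrite acos_ge0 //=; have := acos_lepi c1; lra.
  - by rewrite acosK.
  - by rewrite sin_acos // c2 sqrtr_sqr ger0_norm ?divr_ge0 // ?(ltW r0) // mulrC divfK // lt0r_neq0.
have c1' : -1 <= c < 1.
  have /andP[-> c1''] := c1; rewrite lt_neqAle c1'' andbT.
  apply: contraTneq b0 => cE; move: c2; rewrite cE expr1n subrr => /esym/eqP.
  by rewrite sqrf_eq0 mulf_eq0 invr_eq0 (gt_eqF r0) orbF => /eqP->; rewrite ltxx.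
exists r, (- acos c + 2 * pi * (1%:~R)); split=> //.
- by have := acos_gt0 c1'; have := acos_lepi c1; rewrite mulr1; lra.
- by rewrite cos_periodz cosN acosK.
- rewrite sin_periodz sinN sin_acos // c2 sqrtr_sqr ltr0_norm ?opprK.
    by rewrite mulrC divfK // lt0r_neq0.
  by rewrite pmulr_llt0 // invr_gt0.
Qed.

Lemma int_gap (k : int) : 0 < 2 * (pi : R) * k%:~R < 2 * pi -> False.
Proof.
have p0 : 0 < 2 * pi :> R by rewrite mulr_gt0 // pi_gt0.
rewrite pmulr_rgt0 // -{2}(mulr1 (2 * pi)) ltr_pM2l //.
rewrite ltr0z ltrz1; lia.
Qed.

Section Cyclic.
Context (k : nat) (th : 'I_k -> R).
Hypothesis thP : forall i j : 'I_k, (i < j)%N -> th i < th j < th i + 2 * pi.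

(** The next angle in the listing; the first one, plus a full turn, follows
the last one. *)
Definition next_angle (i : 'I_k) : R :=
  th (ordS i) + 2 * pi * (if (i.+1 < k)%N then 0 else 1 : int)%:~R.

Lemma next_angle_gt i : th i < next_angle i.
Proof.
have p0 := @pi_gt0 R.
rewrite /next_angle; case: ltnP => hi.
  rewrite mulr0 addr0; have /thP/andP[] // : (i < ordS i)%N.
  by rewrite /= modn_small.
rewrite mulr1; case: (posnP i) => i0.
  have k1 : k = 1%N by have := ltn_ord i; lia.
  have -> : ordS i = i by apply/val_inj; rewrite /= i0 [X in (_ %% X)%N]k1.
  by lra.
have /thP/andP[] // : (ordS i < i)%N.
have -> : nat_of_ord (ordS i) = 0%N by have e : i.+1 = k by [have := ltn_ord i; lia]; rewrite /= e modnn.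
by [].
Qed.

(** To pass the angle of i, an angle of at most this index needs at least one
full turn, and an angle of larger index needs none; in both cases it reaches
the next angle as well. *)
Lemma no_between i l (m : int) : ~ (th i < th l + 2 * pi * m%:~R < next_angle i).
Proof.
have p0 := @pi_gt0 R.
move=> /andP[h1 h2].
have hS : (i.+1 < k)%N -> ordS i = i.+1 :> nat by move=> hi; rewrite /= modn_small.
have [li|il] := leqP l i.
  have thli : th l <= th i.
    by move: li; rewrite leq_eqVlt => /orP[/eqP/val_inj->//|/thP/andP[/ltW]].
  have m1 : (1 <= m)%R.
    rewrite -gtz0_ge1 -(ltr0z R); rewrite -(pmulr_rgt0 _ (_ : 0 < 2 * pi)) //; lra.
  have m1R : 1 <= m%:~R :> R by rewrite ler1z.
  have : 2 * pi * 1 <= 2 * pi * m%:~R :> R by rewrite ler_pM2l //; lra.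
  move: h2; rewrite /next_angle; case: ltnP => hi.
    have : (l < ordS i)%N by rewrite hS.
    by move=> /thP/andP[]; rewrite mulr0 addr0; lra.
  have [->|/eqP] := eqVneq (ordS i) l; first by lra.
  have e : i.+1 = k by have := ltn_ord i; lia.
  have S0 : ordS i = 0%N :> nat by rewrite /= e modnn.
  have [l0|l0] := posnP l; first by case; apply/val_inj/(etrans S0)/esym.
  have /thP/andP[] : (ordS i < l)%N by rewrite S0.
  by rewrite mulr1; lra.
have hi : (i.+1 < k)%N by have := ltn_ord l; lia.
move: h2; rewrite /next_angle hi mulr0 addr0 => h2.
have thl : th (ordS i) <= th l.
  have : (ordS i <= l)%N by rewrite hS.
  by rewrite leq_eqVlt => /orP[/eqP/val_inj->//|/thP/andP[/ltW]].
have m1 : (m <= -1)%R.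
  suff : (m < 0)%R by lia.
  by rewrite -(ltrz0 R) -(pmulr_rlt0 _ (_ : 0 < 2 * pi)) //; lra.
have m1R : m%:~R <= - 1 :> R by rewrite -(mulrN1z 1) ler_int.
have : 2 * pi * m%:~R <= 2 * pi * -1 :> R by rewrite ler_pM2l //; lra.
by have /andP[_] := thP il; lra.
Qed.

(** Neither the translate of the angle of j nor that of the next angle is
strictly between the angle of i and the other one, so they coincide. *)
Lemma next_angleP i j (m m' : int) :
  th i + 2 * pi * m%:~R < th j + 2 * pi * m'%:~R ->
  (forall l (m1 : int), ~ (th i + 2 * pi * m%:~R < th l + 2 * pi * m1%:~R
     < th j + 2 * pi * m'%:~R)) ->
  exists m1 : int, th j = th (ordS i) + 2 * pi * m1%:~R.
Proof.
move=> lt h; pose q : int := if (i.+1 < k)%N then 0 else 1.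
exists (q + m - m').
have h1 := h (ordS i) (q + m); have h2 := @no_between i j (m' - m).
have h3 := next_angle_gt i; rewrite /next_angle -/q in h2 h3.
rewrite !rmorphD !rmorphN /= in h1 h2 h3 *.
move: (pi) (q%:~R) (m%:~R) (m'%:~R) lt h1 h2 h3 => P Q M M' lt h1 h2 h3.
have [lt1|gt1|] := ltgtP (th j + 2 * P * M') (th (ordS i) + 2 * P * (Q + M)).
- by exfalso; apply: h2; apply/andP; split; lra.
- by exfalso; apply: h1; apply/andP; split; lra.
- lra.
Qed.

End Cyclic.
End Angles.

(** * Tangent cones of the cells at a point *)

Section Tangent.
Context {R : realType} {d : nat}.
Local Notation E := 'rV[R]_d.
Context {F : set (set E)} {v : E} (HF : fan_at F v).
Implicit Types (x y z w u n : E) (A B C D K H : set E).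

(** The tangent cone of C at z. *)
Definition tangent z C w := exists2 t, 0 < t & C (z + t *: w).

(** The directions that point from z into the interior of C. *)
Definition inner z C w := exists2 e, 0 < e & forall t, 0 < t <= e -> C° (z + t *: w).

(** By convexity the cone contains the whole segment up to a witness of
tangency. *)
Lemma tangent_small z C w : F C -> C z -> tangent z C w ->
  exists2 e, 0 < e & forall t, 0 <= t <= e -> C (z + t *: w).
Proof.
move=> FC Cz [e e0 Ce]; exists e => // t /andP[t0 te].
have -> : z + t *: w = z + (t / e) *: (z + e *: w - z).
  by rewrite addrAC subrr add0r scalerA divfK ?lt0r_neq0.
apply: (mem_cvx HF FC) => //.
by rewrite divr_ge0 ?ler_pdivrMr ?mul1r // ltW.
Qed.

(** Only the inequalities that are equalities at z restrict the directions in
which one can leave z; the others hold near z. *)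
Lemma tangent_half z C : F C -> C z ->
  exists bs : seq E, forall w, tangent z C w <-> forall b, b \in bs -> 0 <= dot b w.
Proof.
move=> FC Cz; have [bs h] := mem_half HF FC.
exists [seq b <- bs | dot b (z - v) == 0] => w; split.
  move=> [t t0 /h hw] b; rewrite mem_filter => /andP[/eqP bz /hw].
  by rewrite addrAC dotDr bz add0r dotZr pmulr_rge0.
move=> hw.
have [b bbs|e e0 he] := @small_all _ _ bs (fun b t => 0 <= dot b (z + t *: w - v)).
  have := h z; case=> /(_ Cz b bbs) bz0 _.
  have [bz|bz] := eqVneq (dot b (z - v)) 0.
    exists 1 => // t /andP[t0 _]; rewrite addrAC dotDr bz add0r dotZr mulr_ge0 //.
    by apply: hw; rewrite mem_filter bz eqxx.
  have bz1 : 0 < dot b (z - v) by rewrite lt_def bz.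
  have q0 : 0 < 1 + `|dot b w| by rewrite ltr_pwDl.
  exists (dot b (z - v) / (1 + `|dot b w|)); first exact: divr_gt0.
  move=> t /andP[t0]; rewrite ler_pdivlMr // => ht.
  rewrite addrAC dotDr dotZr.
  have : - (t * `|dot b w|) <= t * dot b w.
    by rewrite -mulrN ler_wpM2l // lerNl -normrN ler_norm.
  lra.
exists e => //; apply/h => b; apply: he; by rewrite lexx ltW.
Qed.

Lemma tangent_comb z C a b w w' : F C -> C z -> 0 <= a -> 0 <= b ->
  tangent z C w -> tangent z C w' -> tangent z C (a *: w + b *: w').
Proof.
move=> FC Cz a0 b0; have [bs h] := tangent_half FC Cz.
move=> /h hw /h hw'; apply/h => c cbs.
by rewrite dotDr !dotZr addr_ge0 // mulr_ge0 ?hw ?hw'.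
Qed.

Lemma tangentZ z C a w : F C -> C z -> 0 <= a -> tangent z C w ->
  tangent z C (a *: w).
Proof.
move=> FC Cz a0 tw; rewrite -[a *: w]addr0 -(scale0r w).
exact: tangent_comb.
Qed.

Lemma inner_tangent z C w : inner z C w -> tangent z C w.
Proof.
by move=> [e e0 he]; exists e => //; apply: interior_mem; apply: he; rewrite e0 lexx.
Qed.

Lemma tangent_relint z C K U u : K `<=` C -> relint K U z -> u \in U -> tangent z C u.
Proof. by move=> KC [_ h] /h[e e0 Ke]; exists e => //; exact: KC. Qed.

Lemma inner_inj z C D w : F C -> F D -> D z -> inner z C w -> tangent z D w ->
  C = D.
Proof.
move=> FC FD Dz [e e0 he] /(tangent_small FD Dz)[e' e'0 he'].
pose t := Num.min e e'; have t0 : 0 < t by rewrite lt_min; apply/andP; split.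
apply: (cell_inj HF FC FD (x := z + t *: w)).
  by apply: he; rewrite t0 ge_min lexx.
by apply: he'; rewrite (ltW t0) ge_min lexx orbT.
Qed.

Lemma inner_neg z C D H n w : C z -> H z -> unit_normal H C D n ->
  inner z C w -> dot n w < 0.
Proof.
move=> Cz Hz un [e e0 /(_ e)]; rewrite e0 lexx => /(_ isT) Ce.
have := unit_normal_neg un Ce Hz.
by rewrite addrAC subrr add0r dotZr pmulr_rlt0.
Qed.

Lemma tangent_npos z C D H n w : H z -> unit_normal H C D n ->
  tangent z C w -> dot n w <= 0.
Proof.
move=> Hz [_ _ h _] [e e0 /(h z _ Hz)].
by rewrite addrAC subrr add0r dotZr pmulr_rle0.
Qed.

(** Every point near z lies in some cell, and such a cell contains z. *)
Lemma tangent_cover z w : exists D, [/\ cell F D, D z & tangent z D w].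
Proof.
have := @line_continuous _ _ z w 0; rewrite /continuous_at scale0r addr0.
move=> /(_ _ (fan_near HF z)) /nbhs_ballP[e /= e0 he].
have [D [cD De]] := cells_cover HF (z + (e / 2) *: w).
exists D; split=> //; last by exists (e / 2); rewrite ?divr_gt0.
apply: (he (e / 2)) => //; last exact: cD.1.
by rewrite -ball_normE /= sub0r normrN gtr0_norm ?divr_gt0 //; lra.
Qed.

Context (e1 e2 : E).
Definition dir t := cos t *: e1 + sin t *: e2.

Lemma dirE t : dir t = cos t *: e1 + sin t *: e2.
Proof. by []. Qed.

Lemma dir_continuous : continuous dir.
Proof.
move=> t; apply: (@cvgD _ E).
  by apply: cvgZr_tmp; exact: continuous_cos.
by apply: cvgZr_tmp; exact: continuous_sin.
Qed.

Lemma dir_periodz t (m : int) : dir (t + 2 * pi * m%:~R) = dir t.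
Proof. by rewrite /dir sin_periodz cos_periodz. Qed.

Lemma dir_pi t : dir (t + pi) = - dir t.
Proof. by rewrite /dir sinDpi cosDpi !scaleNr opprD. Qed.

(** Expansion of the sine and cosine of (t - t0) + t0. *)
Lemma dirD n t0 t : dot n (dir t0) = 0 ->
  dot n (dir t) = sin (t - t0) * dot n (dir (t0 + pi / 2)).
Proof.
rewrite /dir cosDpihalf sinDpihalf !dotDr !dotZr => h.
have -> : cos t = cos (t - t0) * cos t0 - sin (t - t0) * sin t0.
  by rewrite -cosD subrK.
have -> : sin t = sin (t - t0) * cos t0 + cos (t - t0) * sin t0.
  by rewrite -sinD subrK.
have -> : (cos (t - t0) * cos t0 - sin (t - t0) * sin t0) * dot n e1 +
  (sin (t - t0) * cos t0 + cos (t - t0) * sin t0) * dot n e2 =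
  cos (t - t0) * (cos t0 * dot n e1 + sin t0 * dot n e2) +
  sin (t - t0) * (- sin t0 * dot n e1 + cos t0 * dot n e2) by ring.
by rewrite h mulr0 add0r.
Qed.

(** The coordinates are given by the law of sines. *)
Lemma dir_between a b t : a < b < a + pi -> a <= t <= b ->
  exists k l, [/\ 0 <= k, 0 <= l & dir t = k *: dir a + l *: dir b].
Proof.
move=> /andP[ab ba] /andP[h1 h2].
have s0 : 0 < sin (b - a) by apply: sin_gt0_pi; apply/andP; split; lra.
exists (sin (b - t) / sin (b - a)), (sin (t - a) / sin (b - a)); split.
- by rewrite divr_ge0 ?(ltW s0) // sin_ge0_pi //; apply/andP; split; lra.
- by rewrite divr_ge0 ?(ltW s0) // sin_ge0_pi //; apply/andP; split; lra.
apply: (scalerI (lt0r_neq0 s0)).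
rewrite [RHS]scalerDr !scalerA !mulrA ![sin (b - a) * _]mulrC.
rewrite !mulfK ?lt0r_neq0 //.
rewrite /dir !scalerDr !scalerA addrACA -!scalerDl !sinB.
have ca := cos2Dsin2 a; have cb := cos2Dsin2 b; have ct := cos2Dsin2 t.
by congr (_ *: _ + _ *: _); ring: ca cb ct.
Qed.

Lemma tangent_dir_between z C a b t : F C -> C z -> tangent z C (dir a) ->
  tangent z C (dir b) -> a <= t <= b -> b < a + pi -> tangent z C (dir t).
Proof.
move=> FC Cz ta tb /andP[h1 h2] bp.
have := le_trans h1 h2; rewrite le_eqVlt => /orP[/eqP ab|ab].
  by have -> : t = a by lra.
have [|//|k [l [k0 l0 ->]]] := @dir_between a b t; rewrite ?ab ?h1 //.
exact: tangent_comb.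
Qed.

(** The tangent cone is closed, and the direction depends continuously on the
angle. *)
Lemma not_tangent_near z C t : F C -> C z -> ~ tangent z C (dir t) ->
  exists2 e, 0 < e & forall s, `|s| <= e -> ~ tangent z C (dir (t + s)).
Proof.
move=> FC Cz nt; have [bs h] := tangent_half FC Cz.
have [b bbs bt] : exists2 b, b \in bs & dot b (dir t) < 0.
  apply: contrapT => hn; apply: nt; apply/h => b bbs; rewrite leNgt.
  by apply/negP => hb; apply: hn; exists b.
have ev : \forall s \near t, dot b (dir s) < 0.
  apply: (@dir_continuous t [set w | dot b w < 0]).
  exact: (@dot_continuous _ _ b (dir t) _ (lt_nbhsl bt)).
move: ev => /nbhs_ballP[e /= e0 he]; exists (e / 2); first by rewrite divr_gt0.
move=> s se /h /(_ b bbs); rewrite leNgt => /negP; apply; apply: he.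
rewrite -ball_normE /= opprD addrA subrr sub0r normrN.
by apply: le_lt_trans se _; lra.
Qed.

End Tangent.

(** * Cells around a corib *)

Section Corib.
Context {R : realType} {d : nat}.
Local Notation E := 'rV[R]_d.
Context {F : set (set E)} {v : E} (HF : fan_at F v).
Implicit Types (x y w u n : E) (A B C D H : set E).
Context {K : set E} {U : {vspace E}} {z e1 e2 : E}.
Hypothesis FK : F K.
Hypothesis dU : direction K U.
Hypothesis dimU : (\dim U + 2)%N = d.
Hypothesis rz : relint K U z.
Hypothesis fullE : (U + <[e1]> + <[e2]>)%VS = fullv.
Local Notation dir := (dir e1 e2).
Local Notation tangent := (tangent z).
Local Notation inner := (inner z).

(** A linear relation between e1 and e2 modulo U would make U of codimension
at most 1. *)
Lemma dir_notin t : dir t \notin U.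
Proof.
apply/negP => tU.
suff [w h] : exists w, (fullv <= U + <[w]>)%VS.
  have := dimvS h; rewrite dim_full; have := dim_addline_le U w; have := dimU; lia.
have U1 w : (U <= U + <[w]>)%VS by rewrite addvSl.
have w1 w : w \in (U + <[w]>)%VS by rewrite (subvP (addvSr _ _)) // memv_line.
have [c0|c0] := eqVneq (cos t) 0.
  have s0 : sin t != 0.
    apply/eqP => s0; have := cos2Dsin2 t.
    by rewrite c0 s0 expr0n addr0 => /eqP; rewrite eq_sym oner_eq0.
  exists e1; rewrite -fullE !subv_add U1 -!memvE w1 /=.
  rewrite -(scalerK s0 e2) memvZ //; apply: (subvP (U1 e1)).
  by move: tU; rewrite dirE c0 scale0r add0r.
exists e2; rewrite -fullE !subv_add U1 -!memvE w1 /= andbT.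
rewrite -(scalerK c0 e1) memvZ //.
have -> : cos t *: e1 = dir t - sin t *: e2 by rewrite dirE addrK.
by rewrite rpredB // ?memvZ //; exact: (subvP (U1 e2)).
Qed.

Lemma cell_not_interior C : cell F C -> K `<=` C -> ~ C° z.
Proof.
move=> cC KC Cz; have CK := cell_inj HF cC.1 FK Cz rz.1.
have [_] := (cellP HF C).1 cC; rewrite CK => dK.
have := dimU; rewrite (direction_uniq dU dK) dim_full; lia.
Qed.

(** The common hyperface is larger than K. Modulo the direction of K, one of
its points yields the common direction, whose angle is found by polar
coordinates. *)
Lemma adj_common_dir C D : adj F C D -> K `<=` C -> K `<=` D ->
  exists t, tangent C (dir t) /\ tangent D (dir t).
Proof.
move=> [cC cD CD hH] KC KD; have [V [_ [dV _]]] := mem_dir HF hH.1.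
have [h [Ch Dh] hU] : exists2 h, (C `&` D) h & h - z \notin U.
  apply: contrapT => hn; have : (V <= U)%VS.
    apply: dV.2 => x y Hx Hy; have -> : y - x = (y - z) - (x - z) by vec.
    have hh w : (C `&` D) w -> w - z \in U.
      by move=> Hw; apply/negPn/negP => wU; apply: hn; exists w.
    by rewrite rpredB ?hh.
  move=> /dimvS; have := codim_dir hH dV; have := dimU; lia.
have : h - z \in (U + <[e1]> + <[e2]>)%VS by rewrite fullE memvf.
move=> /memv_addP[w /memv_addP[u uU [_ /vlineP[a ->] ->]] [_ /vlineP[b ->] hE]].
have ab : (a, b) != (0, 0).
  by apply: contra hU => /eqP[a0 b0]; rewrite hE a0 b0 !scale0r !addr0.
have [r [t [r0 _ aE bE]]] := polar ab.
have tE : dir t = r^-1 *: (1 *: (h - z) + 1 *: - u).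
  rewrite hE !scale1r aE bE dirE.
  by apply/rowP => i; rewrite !mxE; field; exact: lt0r_neq0.
exists t; rewrite tE.
have Nu : - u \in U by rewrite memvN.
have r1 : 0 <= r^-1 by rewrite invr_ge0 ltW.
have main A : F A -> K `<=` A -> A h -> tangent A (r^-1 *: (1 *: (h - z) + 1 *: - u)).
  move=> FA KA Ah; have Az := KA _ rz.1.
  apply: (tangentZ HF) => //; apply: (tangent_comb HF) => //; last first.
    exact: (tangent_relint KA rz).
  by exists 1; rewrite // scale1r addrC subrK.
by split; apply: main; rewrite ?cC.1 ?cD.1 //; [exact: cC.1|exact: cD.1].
Qed.

(** The normal vanishes in the common direction t and separates a from b,
hence by the sine formula the two cells lie on the two sides of t. *)
Lemma adj_orient C D a b t : adj F C D -> K `<=` C -> K `<=` D ->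
  inner C (dir a) -> inner D (dir b) -> tangent C (dir t) -> tangent D (dir t) ->
  (sin (a - t) < 0 /\ 0 < sin (b - t)) \/ (sin (b - t) < 0 /\ 0 < sin (a - t)).
Proof.
move=> aCD KC KD iC iD tC tD; have [n un] := adj_normal HF aCD.
have Cz := KC _ rz.1; have Dz := KD _ rz.1.
have nt : dot n (dir t) = 0.
  have h1 := tangent_npos (conj Cz Dz) un tC.
  have := tangent_npos (conj Cz Dz) (unit_normalN un) tD.
  by rewrite dotNl oppr_le0 => h2; apply: le_anti; rewrite h1.
have := inner_neg Cz (conj Cz Dz) un iC.
have := inner_neg Dz (conj Cz Dz) (unit_normalN un) iD.
rewrite dotNl oppr_lt0 (dirD a nt) (dirD b nt); set q := dot n _ => h1 h2.
have [q0|q0|q0] := ltgtP q 0.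
- by right; move: h1 h2; rewrite nmulr_lgt0 // nmulr_llt0.
- by left; move: h1 h2; rewrite pmulr_lgt0 // pmulr_llt0.
- by move: h1; rewrite q0 mulr0 ltxx.
Qed.

(** The angle t is the last one up to which the tangent cone of C extends. It
is less than half a turn away from a, for otherwise the tangent cone contains
a direction opposite to an interior one, and z would be an interior point of
C. *)
Lemma exit_direction C a : cell F C -> K `<=` C -> inner C (dir a) ->
  exists t, [/\ a <= t < a + pi, tangent C (dir t) &
    forall s, t < s < a + pi -> ~ tangent C (dir s)].
Proof.
move=> cC KC iC; have Cz := KC _ rz.1; have p0 := @pi_gt0 R.
pose S := [set t | a <= t <= a + pi /\ tangent C (dir t)].
have Sa : S a by split; [apply/andP; split; lra | exact: inner_tangent].
have ubS : ubound S (a + pi) by move=> t [/andP[]].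
have hS : has_sup S by split; [exists a|exists (a + pi)].
pose t := sup S.
have at1 : a <= t by exact: (ub_le_sup hS.2).
have tp : t <= a + pi by apply: ge_sup => //; exists a.
have tt : tangent C (dir t).
  apply: contrapT => /(not_tangent_near HF cC.1 Cz)[e e0 he].
  have [s [/andP[as1 sp] ts] hs] := sup_adherent e0 hS.
  have st : s <= t by apply: (ub_le_sup hS.2); split=> //; rewrite as1.
  apply: (he (s - t)); last by rewrite addrC subrK.
  rewrite ler_norml; rewrite -/t in hs; apply/andP; split; lra.
exists t; split=> //; last first.
  move=> s /andP[ts sp] Cs; have : s <= t.
    by apply: (ub_le_sup hS.2); split=> //; apply/andP; split; lra.
  by rewrite leNgt ts.
rewrite at1 /= lt_neqAle tp andbT; apply/eqP => tE.
move: tt; rewrite tE dir_pi => /(tangent_small HF cC.1 Cz)[e e0 he].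
have [e' e'0 he'] := iC.
(* z is the midpoint of a point of C and of an interior point of C *)
pose s := Num.min e e'; have s0 : 0 < s by rewrite lt_min; apply/andP.
apply: (cell_not_interior cC KC).
have h1 : C (z + s *: - dir a) by apply: he; rewrite (ltW s0) ge_min lexx.
have h2 : C° (z + s *: dir a) by apply: he'; rewrite s0 ge_min lexx orbT.
have -> : z = (z + s *: - dir a) + (1 / 2) *: (z + s *: dir a - (z + s *: - dir a)).
  by vec.
by apply: (interior_mix HF cC.1 h1 h2); apply/andP; split; lra.
Qed.

Lemma germ_cover t e : 0 < e -> exists s D, [/\ t < s < t + e, cell F D, D z,
  tangent D (dir s) & tangent D (dir t)].
Proof.
move=> e0; have [fs hfs] := fan_seq HF.
have [D Dfs|q q0 hq] := @small_all _ _ fs (fun D s => F D -> D z ->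
    tangent D (dir (t + s)) -> tangent D (dir t)).
  have [[FD [Dz nt]]|h] := pselect (F D /\ D z /\ ~ tangent D (dir t)).
    have [q q0 hq] := not_tangent_near HF FD Dz nt.
    exists q => // s /andP[s0 sq] _ _ ts; exfalso; apply: (hq s) => //.
    by rewrite ger0_norm.
  exists 1 => // s _ FD Dz _; apply: contrapT => nt; apply: h; split=> //.
pose s := Num.min q e / 2.
have m0 : 0 < Num.min q e by rewrite lt_min; apply/andP.
have s0 : 0 < s by rewrite divr_gt0.
have sm : s < Num.min q e by rewrite /s; lra.
have [sq se] : s < q /\ s < e by move: sm; rewrite lt_min => /andP.
have [D [cD Dz Ds]] := tangent_cover HF z (dir (t + s)).
exists (t + s), D; split=> //; first by rewrite ltrDl s0 ltrD2l.
apply: (hq s) => //; first by rewrite !ltW.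
- by apply/hfs; exact: cD.1.
- exact: cD.1.
Qed.

(** Directions slightly beyond the exit angle t lie in other cells. One of
these, D, also contains the direction t; its intersection with C contains K
and the direction t, so it is a hyperface. *)
Lemma next_cell C a : cell F C -> K `<=` C -> inner C (dir a) ->
  exists D t, [/\ adj F C D, K `<=` D, a <= t < a + pi, tangent C (dir t) &
    tangent D (dir t)].
Proof.
move=> cC KC iC; have [t [/andP[at1 tp] Ct ht]] := exit_direction cC KC iC.
have [|s [D [/andP[ts sp] cD Dz Ds Dt]]] := @germ_cover t (a + pi - t).
  by rewrite subr_gt0.
have KD := relint_sub HF cD.1 FK dU rz Dz.
exists D, t; split=> //; last by rewrite at1.
have CD : C <> D.
  by move=> CD; apply: (ht s); rewrite ?CD // ts; lra.
split=> //; have FCD := mem_cap HF cC.1 cD.1.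
have [V [z' [dV _]]] := mem_dir HF FCD.
apply: (dir_codim HF FCD dV); have := cap_dim HF cC cD CD dV.
suff : (\dim U < \dim V)%N by have := dimU; lia.
have Cz := KC _ rz.1.
have UV : (U <= V)%VS by apply: (direction_sub _ dU dV); rewrite subsetI.
have [q q0 hq] := tangent_small HF cC.1 Cz Ct.
have [q' q'0 hq'] := tangent_small HF cD.1 Dz Dt.
pose r := Num.min q q'; have r0 : 0 < r by rewrite lt_min; apply/andP.
have tV : dir t \in V.
  rewrite -(scalerK (lt0r_neq0 r0) (dir t)) memvZ //.
  rewrite -(addKr z (r *: dir t)) addrC; apply: dV.1; first by split.
  by split; [apply: hq|apply: hq']; rewrite (ltW r0) ge_min lexx ?orbT.
rewrite -(dim_addline (dir_notin t)) dimvS // subv_add UV.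
by rewrite -memvE.
Qed.

Section Listing.
Context (k : nat) (L : 'I_k -> set E) (th : 'I_k -> R).
Hypothesis injL : injective L.
Hypothesis cellL : forall A, (cell F A /\ K `<=` A) <-> exists i, A = L i.
Hypothesis innerL : forall i, inner (L i) (dir (th i)).
Hypothesis thP : forall i j : 'I_k, (i < j)%N -> th i < th j < th i + 2 * pi.

Lemma listing_cell i : cell F (L i) /\ K `<=` L i.
Proof. by apply/cellL; exists i. Qed.

Lemma listing_z i : L i z.
Proof. by have [_] := listing_cell i; apply; exact: rz.1. Qed.

Lemma listing_F i : F (L i).
Proof. by have [[]] := listing_cell i. Qed.

(** The directions from the angle of index i to t lie in the cell i, and those
from t to the angle of index j in the cell j. Since the angle of each listed
cell is in its interior, no other listed angle falls between those of i and
j. *)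
Lemma ccw_succ i j (m m' : int) t :
  - pi < th i - t + 2 * pi * m%:~R < 0 -> 0 < th j - t + 2 * pi * m'%:~R < pi ->
  tangent (L i) (dir t) -> tangent (L j) (dir t) -> j = ordS i.
Proof.
move=> /andP[h1 h2] /andP[h3 h4] ti tj; have p0 := @pi_gt0 R.
have [||m1 e] := @next_angleP R k th thP i j m m'; first by lra.
  move=> l m1 /andP[h5 h6].
  have il := innerL l; rewrite -(dir_periodz _ _ _ m1) in il.
  have [lt|lt] := leP (th l + 2 * pi * m1%:~R) t.
    have : tangent (L i) (dir (th l + 2 * pi * m1%:~R)).
      apply: (@tangent_dir_between _ _ _ _ HF _ _ _ _ (th i + 2 * pi * m%:~R) t).
      - exact: listing_F.
      - exact: listing_z.
      - by rewrite dir_periodz; apply: inner_tangent.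
      - by [].
      - by rewrite ltW.
      - lra.
    move=> /(inner_inj HF (listing_F l) (listing_F i) (listing_z i) il)/injL li.
    apply: (@int_gap R (m1 - m)); rewrite intrB -li in h1 h2 h5 h6 lt *.
    by apply/andP; split; lra.
  have : tangent (L j) (dir (th l + 2 * pi * m1%:~R)).
    apply: (@tangent_dir_between _ _ _ _ HF _ _ _ _ t (th j + 2 * pi * m'%:~R)).
    - exact: listing_F.
    - exact: listing_z.
    - by [].
    - by rewrite dir_periodz; apply: inner_tangent.
    - by rewrite !ltW.
    - lra.
  move=> /(inner_inj HF (listing_F l) (listing_F j) (listing_z j) il)/injL lj.
  apply: (@int_gap R (m' - m1)); rewrite intrB -lj in h3 h4 h5 h6 lt *.
  by apply/andP; split; lra.
apply: injL; apply: (inner_inj HF (listing_F _) (listing_F _) (listing_z _) (innerL j)).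
by rewrite e dir_periodz; apply: inner_tangent.
Qed.

(** Up to exchanging the two cells, the second follows the first in the
positive sense. *)
Lemma listing_adj i j : adj F (L i) (L j) -> j = ordS i \/ i = ordS j.
Proof.
move=> aij; have [ci Ki] := listing_cell i; have [cj Kj] := listing_cell j.
have [t [ti tj]] := adj_common_dir aij Ki Kj.
have := adj_orient aij Ki Kj (innerL i) (innerL j) ti tj.
case=> -[/sin_neg_angle[m hm] /sin_pos_angle[m' hm']].
  by left; apply: (ccw_succ hm hm').
by right; apply: (ccw_succ hm hm').
Qed.

(** Some cell is entered when L i is left in the positive sense (next_cell),
and ccw_succ identifies it. *)
Lemma listing_succ i : adj F (L i) (L (ordS i)).
Proof.
have p0 := @pi_gt0 R; have [ci Ki] := listing_cell i.
have [D [t [aD KD /andP[t1 t2] ti tD]]] := next_cell ci Ki (innerL i).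
have [j Dj] : exists j, D = L j by apply/cellL; split=> //; case: aD.
rewrite Dj in aD KD tD.
have := adj_orient aD Ki KD (innerL i) (innerL j) ti tD.
case=> -[/sin_neg_angle[m hm] /sin_pos_angle[m' hm']].
  by rewrite -(ccw_succ hm hm').
have : 0 < sin (th i - t + 2 * pi * m'%:~R) by apply: sin_gt0_pi.
have : 0 <= sin (t - th i) by apply: sin_ge0_pi; apply/andP; split; lra.
by rewrite sin_periodz -(opprB (th i)) sinN; lra.
Qed.

End Listing.
End Corib.

Section CyclicListing.
Context {R : realType} {d : nat}.
Local Notation E := 'rV[R]_d.
Context {F : set (set E)} {v : E} (HF : fan_at F v).
Implicit Types (x y w u n : E) (A B C D H K : set E).

(** In the polar coordinates of a cyclic listing, interior_shift puts the
angle of a cell in the interior of its tangent cone. *)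
Lemma inner_of_interior C K U z p x r w : F C -> F K -> K `<=` C ->
  direction K U -> relint K U z -> K p -> C° x -> 0 < r ->
  (x - p) - r *: w \in U -> inner z C w.
Proof.
move=> FC FK KC dU rz Kp Cx r0 xU.
have [|e e0 he] := @interior_shift _ _ _ _ HF C K U z x (r *: w) FC FK rz KC Cx.
  have -> : x - z - r *: w = (x - p - r *: w) + (p - z) by vec.
  by rewrite rpredD // dU.1 //; exact: rz.1.
exists (e * r); first exact: mulr_gt0.
move=> t /andP[t0 te].
have -> : t *: w = (t / r) *: (r *: w) by rewrite scalerA divfK ?lt0r_neq0.
by apply: he; rewrite divr_gt0 //= ler_pdivrMr.
Qed.

Lemma cyclic_adj K k (L : 'I_k -> set E) : corib F K -> cyclic_cells F K L ->
  (forall i, adj F (L i) (L (ordS i))) /\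
  (forall i j, adj F (L i) (L j) -> j = ordS i \/ i = ordS j).
Proof.
move=> hK [injL cellL [U [e1 [e2 [p [x [r [th [dU fE Kp hx thP]]]]]]]]].
have [U' [z [dU' rz]]] := mem_dir HF hK.1.
rewrite (direction_uniq dU' dU) in rz.
have dimU := codim_dir hK dU.
have iL i : inner z (L i) (dir e1 e2 (th i)).
  have [Cx r0 xU] := hx i.
  have [[FL _] KL] : cell F (L i) /\ K `<=` L i by apply/cellL; exists i.
  exact: (inner_of_interior FL hK.1 KL dU rz Kp Cx r0 xU).
split=> [i|i j].
  exact: (listing_succ HF hK.1 dU dimU rz fE injL cellL iL thP).
exact: (listing_adj HF dimU rz fE injL cellL iL thP).
Qed.

Lemma complement_plane (U : {vspace E}) : (\dim U + 2)%N = d ->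
  exists e1 e2, (U + <[e1]> + <[e2]>)%VS = fullv.
Proof.
move=> dU.
have ext (V : {vspace E}) : (\dim V < d)%N -> exists w, w \notin V.
  move=> h; apply: contrapT => hn.
  suff : V = fullv by move=> Vf; move: h; rewrite Vf dim_full ltnn.
  apply/eqP; rewrite eqEsubv subvf; apply/subvP => w _.
  by apply/negPn/negP => wV; apply: hn; exists w.
have [|w1 h1] := ext U; first by lia.
have [|w2 h2] := ext (U + <[w1]>)%VS; first by rewrite dim_addline //; lia.
exists w1, w2; apply: dim_full_eq; rewrite !dim_addline //; lia.
Qed.

(** Each cell containing K is given the angle of the projection of one of its
interior points. Distinct cells have distinct angles, and sorting the cells by
angle gives the listing. *)
Lemma cyclic_exists K : corib F K ->
  exists k (L : 'I_k -> set E), cyclic_cells F K L.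
Proof.
move=> hK; have [U [z [dU rz]]] := mem_dir HF hK.1.
have dimU := codim_dir hK dU.
have [e1 [e2 fE]] := complement_plane dimU.
have [fs hfs] := fan_seq HF.
pose st := undup [seq C <- fs | `[< cell F C /\ K `<=` C >]].
have stP C : C \in st <-> cell F C /\ K `<=` C.
  rewrite mem_undup mem_filter; split=> [/andP[/asboolP//]|h].
  by apply/andP; split; [exact/asboolP|apply/hfs; exact: h.1.1].
have /choice[f hf] : forall C, exists q : E * R * R, cell F C /\ K `<=` C ->
    [/\ C° q.1.1, 0 < q.1.2, 0 <= q.2 < 2 * pi &
      (q.1.1 - z) - q.1.2 *: dir e1 e2 q.2 \in U].
  move=> C; have [[cC KC]|] := pselect (cell F C /\ K `<=` C); last by exists (0, 0, 0).
  have [x Cx] := cell_interior HF cC.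
  have : x - z \in (U + <[e1]> + <[e2]>)%VS by rewrite fE memvf.
  move=> /memv_addP[w /memv_addP[u uU [_ /vlineP[a ->] ->]] [_ /vlineP[b ->] xE]].
  have ab : (a, b) != (0, 0).
    apply/negP => /eqP[a0 b0]; apply: (cell_not_interior HF hK.1 dU dimU rz cC KC).
    have [|e e0 /(_ e)] := @interior_shift _ _ _ _ HF C K U z x 0 cC.1 hK.1 rz KC Cx.
      by rewrite subr0 xE a0 b0 !scale0r !addr0.
    by rewrite e0 lexx scaler0 addr0; apply.
  have [r [t [r0 tb aE bE]]] := polar ab.
  exists (x, r, t) => _; split=> //=.
  have -> : x - z - r *: dir e1 e2 t = u; last by [].
  by rewrite xE aE bE /dir; vec.
pose th C := (f C).2.
have inn C : C \in st -> inner z C (dir e1 e2 (th C)).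
  move=> /stP h; have [h1 h2 h3 h4] := hf C h.
  exact: (inner_of_interior h.1.1 hK.1 h.2 dU rz rz.1 h1 h2 h4).
have th_inj C D : C \in st -> D \in st -> th C = th D -> C = D.
  move=> hC hD e; have /stP[cC KC] := hC; have /stP[cD KD] := hD.
  apply: (inner_inj HF cC.1 cD.1 (KD _ rz.1) (inn C hC)).
  by rewrite e; apply/inner_tangent/inn.
pose le := [rel C D | th C <= th D].
pose s := sort le st.
have s_sorted : sorted le s by apply: sort_sorted => C D; exact: le_total.
have memS C : C \in s = (C \in st) by rewrite mem_sort.
have uS : uniq s by rewrite sort_uniq undup_uniq.
pose L (i : 'I_(size s)) := nth set0 s i.
have Ls i : L i \in st by rewrite -memS mem_nth.
have injL : injective L.
  by move=> i j /eqP; rewrite nth_uniq // => /eqP/val_inj.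
exists (size s), L; split=> // [A|].
  rewrite -stP -memS; split=> [As|[i ->]]; last by rewrite mem_nth.
  have hi : (index A s < size s)%N by rewrite index_mem.
  by exists (Ordinal hi); rewrite /L /= nth_index.
exists U, e1, e2, z, (fun i => (f (L i)).1.1), (fun i => (f (L i)).1.2).
exists (fun i => th (L i)); split=> //; first exact: rz.1.
  by move=> i; have [h1 h2 h3 h4] := hf _ ((stP _).1 (Ls i)); split.
move=> i j ij; have [_ _ /andP[i1 i2] _] := hf _ ((stP _).1 (Ls i)).
have [_ _ /andP[j1 j2] _] := hf _ ((stP _).1 (Ls j)).
apply/andP; split; last by rewrite /th; lra.
rewrite lt_neqAle; apply/andP; split.
  apply/eqP => /(th_inj _ _ (Ls i) (Ls j))/injL e.
  by move: ij; rewrite e ltnn.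
have le_tr : transitive le by move=> A B C; exact: le_trans.
have le_re : reflexive le by move=> A; exact: lexx.
by apply: (sorted_leq_nth le_tr le_re set0 s_sorted i j); rewrite ?inE ?ltn_ord // ltnW.
Qed.

End CyclicListing.

(** * Integrating jumps over compact convex sets *)

Section Exactness.
Context {R : realType} {d : nat}.
Local Notation E := 'rV[R]_d.
Context {F : set (set E)} {v : E} (HF : fan_at F v).
Implicit Types (x y w u n : E) (A B C D K H T : set E).
Context (j : set E -> set E -> E).

(** The values g solve the equations prescribed by the jumps j, for the pairs
of adjacent cells that meet at some point of T. *)
Definition exact_on T (g : set E -> E) :=
  forall z, T z -> forall C D, adj F C D -> C z -> D z -> g D - g C = j C D.

Definition star_const (V : Type) T (f : set E -> V) :=
  forall z, T z -> forall C D, adj F C D -> C z -> D z -> f C = f D.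

(** The equations are solvable in the star of z, and the star is connected
through adjacent cells; connectedness is stated as the constancy of the
functions that are constant on adjacent pairs. *)
Definition nice z := (exists g, exact_on [set z] g) /\
  forall f : set E -> E, star_const [set z] f ->
  forall C D, cell F C -> cell F D -> C z -> D z -> f C = f D.

Lemma line_near x w t : exists2 e, 0 < e & forall s, `|s| < e ->
  forall C, F C -> C (x + (t + s) *: w) -> C (x + t *: w).
Proof.
have := @line_continuous _ _ x w t; rewrite /continuous_at.
move=> /(_ _ (fan_near HF _)) /nbhs_ballP[e /= e0 he]; exists e => // s se.
by apply: he; rewrite -ball_normE /= opprD addrA subrr sub0r normrN.
Qed.

(** Along a segment in T, the set of parameters at which some cell has the
same value as C is closed; it is also open on the right, as all the cells at a
nice point share one value. *)
Lemma segment_const T (f : set E -> E) : cvxset T -> T `<=` nice ->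
  star_const T f -> forall C D, cell F C -> cell F D ->
  C `&` T !=set0 -> D `&` T !=set0 -> f C = f D.
Proof.
move=> cT nT fT C D cC cD [a [Ca Ta]] [b [Db Tb]].
pose p t := a + t *: (b - a).
have Tp t : 0 <= t <= 1 -> T (p t) by move=> ht; exact: cT.
have star t : 0 <= t <= 1 -> forall A B, cell F A -> cell F B -> A (p t) ->
    B (p t) -> f A = f B.
  move=> ht A B cA cB At Bt; apply: (nT _ (Tp t ht)).2 At Bt => // z ->.
  by move=> A' B' aAB Az Bz; exact: (fT _ (Tp t ht)).
pose S := [set t | 0 <= t <= 1 /\ exists2 A, cell F A /\ A (p t) & f A = f C].
have S0 : S 0.
  by split; [rewrite lexx ler01|exists C => //; split=> //; rewrite /p scale0r addr0].
have hS : has_sup S by split; [exists 0|exists 1 => t [/andP[]]].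
pose t := sup S.
have t0 : 0 <= t by exact: (ub_le_sup hS.2).
have t1 : t <= 1 by apply: ge_sup => [|s [/andP[]]]; [exists 0|].
have t01 : 0 <= t <= 1 by rewrite t0.
have [e e0 he] := line_near a (b - a) t.
have [A [cA At] fA] : exists2 A, cell F A /\ A (p t) & f A = f C.
  have [s [s01 [A [cA As] fA]] ts] := sup_adherent e0 hS.
  have st : s <= t.
    by apply: (ub_le_sup hS.2); split=> //; exists A.
  exists A => //; split=> //; apply: (he (s - t)); last 2 first.
  - exact: cA.1.
  - by rewrite [t + _]addrC subrK.
  by rewrite -/t in ts; rewrite ltr_norml; apply/andP; split; lra.
have tE : t = 1.
  apply/eqP; rewrite eq_le t1 leNgt; apply/negP => tlt.
  pose r := Num.min (e / 2) (1 - t).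
  have r0 : 0 < r by rewrite lt_min; apply/andP; split; lra.
  have re : r <= e / 2 by rewrite ge_min lexx.
  have r1 : r <= 1 - t by rewrite ge_min lexx orbT.
  have [B [cB Bs]] := cells_cover HF (p (t + r)).
  have : t + r <= t.
    apply: (ub_le_sup hS.2); split; first by apply/andP; split; lra.
    exists B; first by split.
    rewrite -fA; apply: (star t) => //; apply: (he r) => //; last exact: cB.1.
    by rewrite gtr0_norm //; lra.
  lra.
rewrite -fA; apply: (star 1) => //; first by rewrite ler01 lexx.
  by rewrite -tE.
by rewrite /p scale1r addrC subrK.
Qed.

Lemma exact_sub T T' g : T `<=` T' -> exact_on T' g -> exact_on T g.
Proof. by move=> TT' gT z /TT'; exact: gT. Qed.

Lemma cvxI T T' : cvxset T -> cvxset T' -> cvxset (T `&` T').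
Proof.
by move=> h h' x y t [Tx Tx'] [Ty Ty'] ht; split; [exact: h|exact: h'].
Qed.

Lemma cvx_hyperplane n b : cvxset [set x | dot n x = b].
Proof. by move=> x y t /= hx hy _; rewrite dotDr dotZr dotBr hx hy subrr mulr0 addr0. Qed.

(** The two solutions differ by a constant on the cells that meet the cutting
hyperplane. A cell that meets both halves of T meets the hyperplane inside T,
by convexity, so shifting one solution by this constant makes the two
agree. *)
Lemma exact_glue T n b : cvxset T -> T `<=` nice ->
  (exists g, exact_on (T `&` [set x | dot n x <= b]) g) ->
  (exists g, exact_on (T `&` [set x | b <= dot n x]) g) -> exists g, exact_on T g.
Proof.
set T1 := _ `&` _; set T2 := _ `&` [set x | b <= _].
move=> cT nT [g1 hg1] [g2 hg2]; pose S := T `&` [set x | dot n x = b].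
have cS : cvxset S by apply: cvxI => //; exact: cvx_hyperplane.
have nS : S `<=` nice by move=> x [/nT].
have cross A : cell F A -> A `&` T1 !=set0 -> A `&` T2 !=set0 -> A `&` S !=set0.
  move=> cA [x [Ax [Tx /= nx]]] [y [Ay [Ty /= ny]]].
  have [e|ne] := eqVneq (dot n x) (dot n y).
    by exists x; split=> //; split=> //=; apply: le_anti; rewrite nx e ny.
  have lt : 0 < dot n y - dot n x.
    by rewrite subr_gt0 lt_neqAle ne (le_trans nx ny).
  pose t := (b - dot n x) / (dot n y - dot n x).
  have t01 : 0 <= t <= 1.
    by rewrite divr_ge0 ?subr_ge0 ?(ltW lt) ?ler_pdivrMr // ?mul1r; lra.
  exists (x + t *: (y - x)); split; first exact: (mem_cvx HF cA.1).
  split; first exact: cT.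
  by rewrite /= dotDr dotZr dotBr divfK ?lt0r_neq0 // addrC subrK.
have sc : star_const S (fun A => g1 A - g2 A).
  move=> z [Tz Sz] A B aAB Az Bz.
  have z1 : T1 z by split=> //=; rewrite Sz.
  have z2 : T2 z by split=> //=; rewrite Sz.
  have e : g1 B - g1 A = g2 B - g2 A.
    by rewrite (hg1 z z1 A B) // (hg2 z z2 A B).
  have -> : g1 B = g1 A + (g2 B - g2 A) by rewrite -e addrC subrK.
  by vec.
have [q hq] : exists q, forall A, cell F A -> A `&` S !=set0 -> g1 A = g2 A + q.
  have [[A0 [cA0 A0S]]|hn] := pselect (exists A, cell F A /\ A `&` S !=set0).
    exists (g1 A0 - g2 A0) => A cA AS.
    by rewrite -(segment_const cS nS sc cA cA0 AS A0S) addrC subrK.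
  by exists 0 => A cA AS; exfalso; apply: hn; exists A.
exists (fun A => if `[< A `&` T1 !=set0 >] then g1 A else g2 A + q).
move=> z Tz A B aAB Az Bz; have [cA cB _ _] := aAB.
have [nz|/ltW nz] := leP (dot n z) b.
  rewrite !asboolT; [exact: (hg1 z)|by exists z|by exists z].
have main D : cell F D -> D z ->
    (if `[< D `&` T1 !=set0 >] then g1 D else g2 D + q) = g2 D + q.
  move=> cD Dz; case: asboolP => // DT1; apply: hq => //.
  by apply: cross => //; exists z.
by rewrite !main // -(hg2 z _ A B) //; vec.
Qed.

Definition box (lo hi : 'I_d -> R) : set E :=
  [set x | forall i, lo i <= x 0 i <= hi i].

Lemma box_cvx lo hi : cvxset (box lo hi).
Proof.
move=> x y t hx hy /andP[t0 t1] i; have := hx i; have := hy i; rewrite !mxE.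
by move=> /andP[? ?] /andP[? ?]; apply/andP; split; nra.
Qed.

(** A Lebesgue number for the cover of T by neighbourhoods whose points lie
only in cells of the star of their centre. *)
Lemma small_exact T : compact T -> T `<=` nice -> exists2 e, 0 < e &
  forall x, T x -> exists g, exact_on (T `&` ball x e) g.
Proof.
move=> cptT nT.
have [|e /= e0 he] := (compact_near_coveringP T).1 cptT R (0 : R)^'+
  (fun e x => exists g, exact_on (T `&` ball x e) g) _.
  move=> x Tx; have [[g hg] _] := nT x Tx.
  have /nbhs_ballP[r /= r0 hr] := fan_near HF x.
  exists (ball x (r / 2), [set e | e < r / 2]).
    split; first by apply: nbhsx_ballx; rewrite divr_gt0.
    by apply: nbhs_right_lt; rewrite divr_gt0.
  move=> [x' e] /= [bx' le]; exists g => z [Tz bz] C D aCD Cz Dz.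
  have [cC cD _ _] := aCD.
  have bxz : ball x r z.
    rewrite [r]splitr; apply: (ball_triangle bx').
    by apply: le_ball bz; exact: ltW.
  by apply: (hg x) => //; [apply: (hr z) => //; exact: cC.1|apply: (hr z) => //; exact: cD.1].
exists (e / 2); first by rewrite divr_gt0.
move=> x Tx; apply: he => //=; last by rewrite divr_gt0.
by rewrite sub0r normrN gtr0_norm ?divr_gt0 //; lra.
Qed.

(** The box is cut into pieces smaller than the Lebesgue number, one
coordinate at a time, and the solutions on the pieces are glued. The induction
on m lets the first m sides of the box be arbitrary; the induction on N counts
the slabs in direction m. *)
Lemma compact_exact T lo hi : cvxset T -> compact T -> T `<=` nice ->
  T `<=` box lo hi -> exists g, exact_on T g.
Proof.
move=> cT cptT nT Tbox; have [e e0 he] := small_exact cptT nT.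
suff main m : (m <= d)%N -> forall lo hi : 'I_d -> R,
    (forall i : 'I_d, (m <= i)%N -> hi i - lo i <= e / 2) ->
    exists g, exact_on (T `&` box lo hi) g.
  have [i|g hg] := main d (leqnn d) lo hi.
    by rewrite leqNgt ltn_ord.
  by exists g; apply: exact_sub hg => x Tx; split=> //; exact: Tbox.
elim: m => [|m IH] md {lo hi Tbox} lo hi hlh.
  have [[x [Tx bx]]|hn] := pselect (T `&` box lo hi !=set0); last first.
    by exists (fun=> 0) => x Tx; exfalso; apply: hn; exists x.
  have [g hg] := he x Tx; exists g; apply: exact_sub hg => y [Ty by_].
  split=> //; split=> // i i'; rewrite (ord1 i).
  rewrite /ball /= ltr_norml; have := hlh i' isT; have := bx i'; have := by_ i'.
  by move=> /andP[? ?] /andP[? ?] ?; apply/andP; split; lra.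
pose im : 'I_d := Ordinal md.
have [N hN] : exists N : nat, hi im - lo im <= N%:R * (e / 2).
  exists (Num.truncn ((hi im - lo im) / (e / 2))).+1.
  rewrite -ler_pdivrMr ?divr_gt0 //; apply: ltW; exact: truncnS_gt.
elim: N lo hi hlh hN => [|N IHN] lo hi hlh hN.
  apply: IH => [|i mi]; first exact: ltnW.
  have [e1|] := eqVneq i im; last by move=> ne; apply: hlh; rewrite ltn_neqAle mi andbT eq_sym.
  by rewrite e1; lra.
pose b := lo im + e / 2.
pose lo' i := if i == im then b else lo i.
pose hi' i := if i == im then b else hi i.
apply: (@exact_glue _ (delta_mx 0 im) b).
- by apply: cvxI => //; exact: box_cvx.
- by move=> x [/nT].
- have [i mi|g hg] := IH (ltnW md) lo hi'.
    rewrite /hi'; case: eqVneq => [->|ne]; first by rewrite /b; lra.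
    by apply: hlh; rewrite ltn_neqAle mi andbT eq_sym.
  exists g; apply: exact_sub hg => x [[Tx bx] /=]; rewrite dotC dot_delta => xb.
  split=> // i; have /andP[h1 h2] := bx i; rewrite h1 /hi' /=.
  by case: eqVneq => [->|].
- have [||g hg] := IHN lo' hi.
  + move=> i mi; rewrite /lo'; case: eqVneq => [e1|_]; last exact: hlh.
    by move: mi; rewrite e1 ltnn.
  + by rewrite /lo' eqxx /b; move: hN; rewrite -natr1 mulrDl mul1r; lra.
  exists g; apply: exact_sub hg => x [[Tx bx] /=]; rewrite dotC dot_delta => xb.
  split=> // i; have /andP[h1 h2] := bx i; rewrite h2 /lo' andbT.
  by case: eqVneq => [->|].
Qed.

End Exactness.

(** * Triangles *)

Section Triangle.
Context {R : realType} {d : nat}.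
Local Notation E := 'rV[R]_d.
Implicit Types p q r : E.

Definition triangle p q r : set E := [set x | exists a b c : R,
  [/\ 0 <= a, 0 <= b, 0 <= c, a + b + c = 1 & x = a *: p + b *: q + c *: r]].

Lemma triangle_cvx p q r : cvxset (triangle p q r).
Proof.
move=> _ _ t [a [b [c [a0 b0 c0 e ->]]]] [a' [b' [c' [a'0 b'0 c'0 e' ->]]]] /andP[t0 t1].
have t1' : 0 <= 1 - t by rewrite subr_ge0.
exists ((1 - t) * a + t * a'), ((1 - t) * b + t * b'), ((1 - t) * c + t * c').
split; rewrite ?addr_ge0 ?mulr_ge0 //; last by vec.
transitivity ((1 - t) * (a + b + c) + t * (a' + b' + c')); first by ring.
by rewrite e e'; ring.
Qed.

Lemma triangle1 p q r : triangle p q r p.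
Proof. by exists 1, 0, 0; split; rewrite ?addr0 // !scale0r scale1r !addr0. Qed.

Lemma triangle2 p q r : triangle p q r q.
Proof. by exists 0, 1, 0; split; rewrite ?add0r ?addr0 // !scale0r scale1r addr0 add0r. Qed.

Lemma triangle3 p q r : triangle p q r r.
Proof. by exists 0, 0, 1; split; rewrite ?add0r ?addr0 // !scale0r scale1r !add0r. Qed.

Lemma triangle_sub p q r p' q' r' : triangle p q r p' -> triangle p q r q' ->
  triangle p q r r' -> triangle p' q' r' `<=` triangle p q r.
Proof.
move=> [a1 [b1 [c1 [a10 b10 c10 e1 ->]]]] [a2 [b2 [c2 [a20 b20 c20 e2 ->]]]].
move=> [a3 [b3 [c3 [a30 b30 c30 e3 ->]]]] _ [a [b [c [a0 b0 c0 e ->]]]].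
exists (a * a1 + b * a2 + c * a3), (a * b1 + b * b2 + c * b3),
  (a * c1 + b * c2 + c * c3).
split; rewrite ?addr_ge0 ?mulr_ge0 //; last by vec.
transitivity (a * (a1 + b1 + c1) + b * (a2 + b2 + c2) + c * (a3 + b3 + c3)).
  by ring.
by rewrite e1 e2 e3 !mulr1.
Qed.

(** The triangle is the image of a square. *)
Lemma triangle_compact p q r : compact (triangle p q r).
Proof.
pose f (u : R * R) : E := p + u.1 *: (q - p) + (u.1 * u.2) *: (r - q).
have -> : triangle p q r = f @` (`[0, 1] `*` `[0, 1]).
  apply/seteqP; split=> [_ [a [b [c [a0 b0 c0 e ->]]]]|_ [[s t] [/= hs ht] <-]].
    have [bc|bc] := eqVneq (b + c) 0.
      exists (0, 0); first by split; rewrite /= in_itv /= lexx ler01.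
      have b0' : b = 0 by lra.
      have c0' : c = 0 by lra.
      have a1 : a = 1 by lra.
      by rewrite /f /= b0' c0' a1; vec.
    have bc0 : 0 < b + c by rewrite lt_def bc addr_ge0.
    exists (b + c, c / (b + c)).
      split; rewrite /= in_itv /=; first by apply/andP; split; lra.
      by rewrite divr_ge0 ?(ltW bc0) // ler_pdivrMr // mul1r lerDr.
    rewrite /f /= mulrC divfK // (_ : a = 1 - b - c); last by lra.
    by vec.
  move: hs ht; rewrite !in_itv /= => /andP[s0 s1] /andP[t0 t1].
  exists (1 - s), (s - s * t), (s * t); split; rewrite ?mulr_ge0 ?subr_ge0 //.
  - by rewrite ler_piMr.
  - by ring.
  - by rewrite /f /=; vec.
apply: continuous_compact; last first.
  by apply: compact_setX; exact: segment_compact.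
apply: continuous_subspaceT => u; rewrite /f.
apply: (@cvgD _ E); last first.
  apply: cvgZr_tmp; apply: cvgM; [exact: cvg_fst|exact: cvg_snd].
apply: (@cvgD _ E); first exact: cvg_cst.
by apply: cvgZr_tmp; exact: cvg_fst.
Qed.

Lemma triangle_box p q r : exists lo hi : 'I_d -> R, triangle p q r `<=` box lo hi.
Proof.
pose M i := `|p 0 i| + `|q 0 i| + `|r 0 i|.
exists (fun i => - M i), M => _ [a [b [c [a0 b0 c0 e ->]]]] i; rewrite -ler_norml !mxE.
apply: le_trans (ler_normD _ _) _; apply: lerD.
  apply: le_trans (ler_normD _ _) _; apply: lerD.
    by rewrite normrM ger0_norm // ler_piMl //; lra.
  by rewrite normrM ger0_norm // ler_piMl //; lra.
by rewrite normrM ger0_norm // ler_piMl //; lra.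
Qed.

End Triangle.

(** * The potential of a canonical scaling *)

Section Potential.
Context {R : realType} {d : nat}.
Local Notation E := 'rV[R]_d.
Context {F : set (set E)} {v : E} (HF : fan_at F v).
Implicit Types (x y w u n : E) (A B C D K H T : set E).
Context (s : set E -> R) (canon : canonical_scaling F s).

(** The vector prescribed by the scaling for the passage from C to D. The unit
normal is obtained by choice; for adjacent cells it is unique. *)
Definition jump C D : E :=
  s (C `&` D) *: xget 0 [set n | unit_normal (C `&` D) C D n].

Lemma jumpE C D n : adj F C D -> unit_normal (C `&` D) C D n ->
  jump C D = s (C `&` D) *: n.
Proof.
move=> aCD un; rewrite /jump; congr (_ *: _).
have [cC _ _ hH] := aCD.
apply: (normal_prop HF cC hH un).
by apply: (@xgetPex _ 0 [set n | unit_normal (C `&` D) C D n]); exists n.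
Qed.

Lemma jumpN C D : adj F C D -> jump D C = - jump C D.
Proof.
move=> aCD; have [n un] := adj_normal HF aCD; rewrite (jumpE aCD un).
rewrite (jumpE (n := - n) (adj_sym aCD)); last by rewrite setIC; exact: unit_normalN.
by rewrite setIC scalerN.
Qed.

Lemma nice_cell z K : cell F K -> (forall A, F A -> A z -> K `<=` A) ->
  nice (F := F) jump z.
Proof.
move=> cK hK; have [x Kx] := cell_interior HF cK.
have uniqK C : cell F C -> C z -> C = K.
  move=> cC Cz; apply/esym/(cell_inj HF cK.1 cC.1 Kx).
  by apply: hK => //; [exact: cC.1|exact: interior_mem].
split; last by move=> f _ C D cC cD /(uniqK C cC)-> /(uniqK D cD)->.
exists (fun=> 0) => _ -> C D [cC cD CD _] Cz Dz; exfalso; apply: CD.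
by rewrite (uniqK C) // (uniqK D).
Qed.

(** The star consists of at most two cells. *)
Lemma nice_hyperface z K : hyperface F K ->
  (forall A, F A -> A z -> K `<=` A) -> nice (F := F) jump z.
Proof.
move=> hypK hK; have [C0 [cC0 C0z]] := cells_cover HF z.
split; last first.
  move=> f fS C D cC cD Cz Dz; have [->//|/eqP CD] := eqVneq C D.
  apply: (fS z) => //; have [] // := adj_sup HF cC cD CD hypK.
    by apply: hK => //; exact: cC.1.
  by apply: hK => //; exact: cD.1.
exists (fun X => if X == C0 then 0 else jump C0 X) => _ -> C D aCD Cz Dz.
have [cC cD CD _] := aCD.
have [CE|/eqP/nesym CN] := eqVneq C C0.
  have [DE|_] := eqVneq D C0; first by exfalso; apply: CD; rewrite CE DE.
  by rewrite subr0 -CE.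
have [DE|/eqP/nesym DN] := eqVneq D C0.
  by rewrite sub0r -DE -jumpN ?opprK //; exact: adj_sym.
exfalso; apply: CD; apply: (two_cells HF hypK cC0 cC cD) => //.
- by apply: hK => //; exact: cC0.1.
- by apply: hK => //; exact: cC.1.
- by apply: hK => //; exact: cD.1.
Qed.

(** The cells of the star are listed cyclically, and adjacent ones are
consecutive. The partial sums of the jumps solve the equations, and the
vanishing torsion is the compatibility condition on the last pair. *)
Lemma nice_corib z K : corib F K -> K z ->
  (forall A, F A -> A z -> K `<=` A) -> nice (F := F) jump z.
Proof.
move=> hypK Kz hK; have [k [L [n [cyc un sum0]]]] := canon hypK.
have [aL sL] := cyclic_adj HF hypK cyc.
have [injL cellL _] := cyc.
have starL C : cell F C -> C z -> exists i, C = L i.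
  by move=> cC Cz; apply/cellL; split=> //; apply: hK => //; exact: cC.1.
split; last first.
  move=> f fS.
  have Lz i : L i z by have [_] : cell F (L i) /\ K `<=` L i; [apply/cellL; exists i|apply].
  have fL m (i i0 : 'I_k) : i = m :> nat -> i0 = 0%N :> nat -> f (L i) = f (L i0).
    elim: m i => [|m IH] i im i00; first by congr (f (L _)); apply/val_inj; rewrite /= im.
    have mk : (m < k)%N by have := ltn_ord i; lia.
    have -> : i = ordS (Ordinal mk).
      by apply/val_inj; rewrite /= -im modn_small.
    by rewrite -(fS z _ _ _ (aL _)) // IH.
  move=> C D cC cD Cz Dz; have [i ->] := starL C cC Cz; have [l ->] := starL D cD Dz.
  have k0 : (0 < k)%N by have := ltn_ord i; lia.
  by rewrite (fL i i (Ordinal k0)) // (fL l l (Ordinal k0)).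
pose w i := jump (L i) (L (ordS i)).
have w0 : \sum_i w i = 0.
  by rewrite [RHS]sum0; apply: eq_bigr => i _; rewrite /w (jumpE (aL i) (un i)).
pose G (i : 'I_k) := \sum_(l < k | (l < i)%N) w l.
have GS i : G (ordS i) - G i = w i.
  have [hi|hi] := ltnP i.+1 k.
    rewrite /G (bigD1 i) /=; last by rewrite modn_small.
    rewrite -addrA [X in _ + X](_ : _ = 0) ?addr0 //; apply/eqP; rewrite subr_eq0.
    apply/eqP/eq_bigl => l; rewrite modn_small // ltnS andbC -ltn_neqAle.
    by [].
  have e : i.+1 = k by have := ltn_ord i; lia.
  rewrite /G big_pred0 ?sub0r => [|l]; last by rewrite /= [X in (X %% _)%N]e modnn.
  move: w0; rewrite (bigD1 i) //= => /eqP; rewrite addr_eq0 => /eqP->.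
  congr (- _); apply: eq_bigl => l; have := ltn_ord l; rewrite -(inj_eq val_inj) /=; lia.
have /choice[g hg] : forall X, exists q, forall i, X = L i -> q = G i.
  move=> X; have [[i ->]|hn] := pselect (exists i, X = L i).
    by exists (G i) => l /injL ->.
  by exists 0 => i Xi; exfalso; apply: hn; exists i.
exists g => _ -> C D aCD Cz Dz; have [cC cD _ _] := aCD.
have [i Ci] := starL C cC Cz; have [l Dl] := starL D cD Dz.
rewrite (hg _ i Ci) (hg _ l Dl); rewrite {}Ci {}Dl in aCD *.
case: (sL _ _ aCD) => e; first by rewrite e GS.
by rewrite (jumpN (adj_sym aCD)) e -[jump _ _]/(w l) -GS opprB.
Qed.

(** The smallest member containing z has codimension 0, 1 or 2. *)
Lemma nice_codim2 z : (forall A V, F A -> A z -> direction A V ->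
  (d <= \dim V + 2)%N) -> nice (F := F) jump z.
Proof.
move=> hz; have [K [FK Kz hK]] := minface HF z.
have [V [z' [dV _]]] := mem_dir HF FK.
have h1 := hz K V FK Kz dV; have h2 := dim_le V.
have [e|n0] := eqVneq (\dim V + 0)%N d.
  by apply: (nice_cell (K := K)) => //; exact: (dir_codim HF FK dV e).
have [e|n1] := eqVneq (\dim V + 1)%N d.
  by apply: (nice_hyperface (K := K)) => //; exact: (dir_codim HF FK dV e).
apply: (nice_corib (K := K)) => //; apply: (dir_codim HF FK dV); lia.
Qed.

Lemma sub_direction A (W V : {vspace E}) : (forall x, A x -> x - v \in W) ->
  direction A V -> (V <= W)%VS.
Proof.
move=> h [_ hV]; apply: hV => x y Ax Ay.
have -> : y - x = (y - v) - (x - v) by vec.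
by rewrite rpredB ?h.
Qed.

Lemma avoid_directions A V (ws : seq {vspace E}) : F A -> direction A V ->
  (forall W, W \in ws -> ~ (V <= W)%VS) ->
  exists2 a, A a & forall W, W \in ws -> a - v \notin W.
Proof.
move=> FA dV h; apply: convex_avoid; first exact: (mem_cvx HF FA).
  by exists v; exact: mem_vertex HF _ FA.
move=> W Ws; apply: contrapT => hn; apply: (h W Ws); apply: (sub_direction _ dV).
by move=> x Ax; apply/negPn/negP => xW; apply: hn; exists x.
Qed.

(** Points p0, p C in each cell C and q H in each hyperface H are chosen in
general position, so that the triangles p0, p C, q H avoid the members of
codimension at least 3. The value at C is the difference of values at C and at
the cell of p0, along the segment from p0 to p C. For adjacent C and D with
common hyperface H, these values are compared in the triangles over C and over
D, which share the segment from p0 to q H. *)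
Lemma potential : exists g : set E -> E, forall C D, adj F C D -> g D - g C = jump C D.
Proof.
have [fs hfs] := fan_seq HF.
have /choice[f hf] : forall C, exists U, F C -> direction C U.
  move=> C; have [FC|] := pselect (F C); last by exists fullv.
  by have [U [z [dU _]]] := mem_dir HF FC; exists U.
(* directions of the members that are not cells, and of those of codimension
   at least 3 *)
pose noncells := [seq W <- map f fs | (\dim W < d)%N].
pose low := [seq W <- map f fs | ((\dim W).+2 < d)%N].
have [C0 [cC0 _]] := cells_cover HF v.
have dimcell C : cell F C -> \dim (f C) = d.
  by move=> cC; rewrite -[RHS](codim_dir cC (hf C cC.1)) addn0.
have [W|p0 C0p0 hp0] := avoid_directions (ws := noncells) cC0.1 (hf _ cC0.1).
  by rewrite mem_filter => /andP[Wd _] /dimvS; rewrite dimcell //; lia.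
have p0low W : W \in low -> p0 - v \notin W.
  move=> hW; apply: hp0; move: hW; rewrite !mem_filter => /andP[h ->].
  by rewrite andbT; lia.
have /choice[p hp] : forall C, exists q, cell F C -> C q /\
    forall W, W \in low -> q - v \notin (W + <[p0 - v]>)%VS.
  move=> C; have [cC|] := pselect (cell F C); last by exists 0.
  have [W'|q Cq hq] := @avoid_directions C (f C)
      [seq (W + <[p0 - v]>)%VS | W <- low] cC.1 (hf _ cC.1).
    move=> /mapP[W]; rewrite mem_filter => /andP[Wd _] -> /dimvS.
    have Wd' : ((\dim W).+1 < d)%N by exact: ltnW Wd.
    rewrite dimcell // => h.
    by have := leq_ltn_trans (leq_trans h (dim_addline_le _ _)) Wd'; rewrite ltnn.
  by exists q => _; split=> // W Wl; apply: hq; exact: map_f.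
pose cells := [seq C <- fs | `[< cell F C >]].
have cellsP C : cell F C -> C \in cells.
  by move=> cC; rewrite mem_filter; apply/andP; split; [exact/asboolP|apply/hfs; exact: cC.1].
have /choice[q hq] : forall H, exists q, hyperface F H -> H q /\
    forall C W, cell F C -> W \in low ->
      q - v \notin (W + <[p0 - v]> + <[p C - v]>)%VS.
  move=> H; have [hH|] := pselect (hyperface F H); last by exists 0.
  have dH := codim_dir hH (hf _ hH.1).
  have [W'|q Hq hq] := @avoid_directions H (f H)
      [seq (W + <[p0 - v]> + <[p C - v]>)%VS | W <- low, C <- cells] hH.1 (hf _ hH.1).
    move=> /allpairsP[[W C] /= []]; rewrite mem_filter => /andP[Wd _] Cs -> sub.
    have : p0 - v \notin f H.
      apply: hp0; rewrite mem_filter map_f ?andbT; first by lia.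
      by apply/hfs; exact: hH.1.
    suff -> : f H = (W + <[p0 - v]> + <[p C - v]>)%VS.
      by move=> /negP; apply; apply: (subvP (addvSl _ _)); apply: (subvP (addvSr _ _)); exact: memv_line.
    apply/eqP; rewrite eqEdim sub /=.
    apply: leq_trans (dim_addline_le _ _) _.
    apply: leq_ltn_trans (dim_addline_le _ _) _.
    have : ((\dim W).+2 < \dim (f H) + 1)%N by rewrite dH.
    by rewrite addn1 ltnS.
  exists q => _; split=> // C W cC Wl; apply: hq.
  by apply/allpairsP; exists (W, C); split=> //; exact: cellsP.
have nice_pt z : (forall W, W \in low -> z - v \notin W) -> nice (F := F) jump z.
  move=> hz; apply: nice_codim2 => A V FA Az dV; rewrite leqNgt; apply/negP => lt.
  have : f A \in low.
    rewrite mem_filter map_f ?andbT; last exact/hfs.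
    by rewrite (direction_uniq (hf _ FA) dV); lia.
  by move=> /hz/negP; apply; apply: (hf _ FA).1 => //; exact: mem_vertex HF _ FA.
(* a point of the triangle in a member of codimension at least 3 would give a
   linear relation between the three vertices modulo the direction of that
   member *)
have tri_nice x y : (forall W, W \in low -> x - v \notin (W + <[p0 - v]>)%VS) ->
    (forall W, W \in low -> y - v \notin (W + <[p0 - v]> + <[x - v]>)%VS) ->
    triangle p0 x y `<=` nice (F := F) jump.
  move=> hx hy _ [a [b [c [a0 b0 c0 e ->]]]]; apply: nice_pt => W Wl; apply/negP.
  have -> : a *: p0 + b *: x + c *: y - v =
      c *: (y - v) + (a *: (p0 - v) + b *: (x - v)).
    by have -> : a = 1 - b - c; [lra|vec].
  have W1 : (W <= W + <[p0 - v]>)%VS by rewrite addvSl.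
  have L1 : p0 - v \in (W + <[p0 - v]>)%VS.
    by apply: (subvP (addvSr _ _)); exact: memv_line.
  have W2 : (W + <[p0 - v]> <= W + <[p0 - v]> + <[x - v]>)%VS by rewrite addvSl.
  have L2 : x - v \in (W + <[p0 - v]> + <[x - v]>)%VS.
    by apply: (subvP (addvSr _ _)); exact: memv_line.
  have [cz|cn] := eqVneq c 0; last first.
    move=> /(subvP W1)/(subvP W2) h; case/negP: (hy W Wl).
    rewrite -(scalerK cn (y - v)) memvZ //.
    rewrite -(addrK (a *: (p0 - v) + b *: (x - v)) (c *: (y - v))) rpredB //.
    by rewrite rpredD ?memvZ //; exact: (subvP W2).
  rewrite cz scale0r add0r; have [bz|bn] := eqVneq b 0; last first.
    move=> /(subvP W1) h; case/negP: (hx W Wl).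
    rewrite -(scalerK bn (x - v)) memvZ //.
    rewrite -(addKr (a *: (p0 - v)) (b *: (x - v))) rpredD // rpredN memvZ //.
  have -> : a = 1 by lra.
  by rewrite bz scale0r addr0 scale1r => h; case/negP: (p0low W Wl).
have tri_exact x y : triangle p0 x y `<=` nice (F := F) jump ->
    exists g, exact_on (F := F) jump (triangle p0 x y) g.
  move=> nT; have [lo [hi hb]] := triangle_box p0 x y.
  exact: (compact_exact HF (@triangle_cvx _ _ p0 x y) (@triangle_compact _ _ p0 x y) nT hb).
have seg_nice C : cell F C -> triangle p0 p0 (p C) `<=` nice (F := F) jump.
  move=> cC _ [a [b [c [a0 b0 c0 e ->]]]]; apply: nice_pt => W Wl; apply/negP.
  have -> : a *: p0 + b *: p0 + c *: p C - v =
      c *: (p C - v) + (1 - c) *: (p0 - v).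
    by have -> : a = 1 - b - c; [lra|vec].
  have [cz|cn] := eqVneq c 0.
    by rewrite cz scale0r add0r subr0 scale1r; apply/negP; exact: p0low.
  have L1 : p0 - v \in (W + <[p0 - v]>)%VS.
    by apply: (subvP (addvSr _ _)); exact: memv_line.
  move=> /(subvP (addvSl W <[p0 - v]>)) h; case/negP: ((hp C cC).2 W Wl).
  rewrite -(scalerK cn (p C - v)) memvZ //.
  by rewrite -(addrK ((1 - c) *: (p0 - v)) (c *: (p C - v))) rpredB // memvZ.
have /choice[gs hgs] : forall C, exists g, cell F C ->
    exact_on (F := F) jump (triangle p0 p0 (p C)) g.
  move=> C; have [cC|] := pselect (cell F C); last by exists (fun=> 0).
  by have [g hg] := tri_exact _ _ (seg_nice C cC); exists g.
have compare T g1 g2 : cvxset T -> T `<=` nice (F := F) jump ->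
    exact_on (F := F) jump T g1 -> exact_on (F := F) jump T g2 ->
    forall C D, cell F C -> cell F D -> C `&` T !=set0 -> D `&` T !=set0 ->
    g1 D - g1 C = g2 D - g2 C.
  move=> cT nT h1 h2 C D cC cD CT DT.
  have : g1 C - g2 C = g1 D - g2 D.
    apply: (segment_const HF (T := T) (f := fun A => g1 A - g2 A) cT nT) => //.
    move=> z Tz A B aAB Az Bz.
    have e : g1 B - g1 A = g2 B - g2 A by rewrite (h1 z) // (h2 z).
    have -> : g1 B = g1 A + (g2 B - g2 A) by rewrite -e addrC subrK.
    by vec.
  move=> e; have -> : g1 D = (g1 C - g2 C) + g2 D by rewrite e subrK.
  by vec.
exists (fun C => gs C C - gs C C0) => C D aCD; have [cC cD _ hH] := aCD.
have [[Cq Dq] hqq] := hq _ hH; set qH := q (C `&` D) in Cq Dq hqq.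
have [Cp hpC] := hp C cC; have [Dp hpD] := hp D cD.
have nC := tri_nice _ _ hpC (fun W => hqq C W cC).
have nD := tri_nice _ _ hpD (fun W => hqq D W cD).
have [gC hgC] := tri_exact _ _ nC; have [gD hgD] := tri_exact _ _ nD.
have segC : triangle p0 p0 (p C) `<=` triangle p0 (p C) qH.
  by apply: triangle_sub; [exact: triangle1|exact: triangle1|exact: triangle2].
have segD : triangle p0 p0 (p D) `<=` triangle p0 (p D) qH.
  by apply: triangle_sub; [exact: triangle1|exact: triangle1|exact: triangle2].
have qC : triangle p0 p0 qH `<=` triangle p0 (p C) qH.
  by apply: triangle_sub; [exact: triangle1|exact: triangle1|exact: triangle3].
have qD : triangle p0 p0 qH `<=` triangle p0 (p D) qH.
  by apply: triangle_sub; [exact: triangle1|exact: triangle1|exact: triangle3].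
have meet0 x : C0 `&` triangle p0 p0 x !=set0.
  by exists p0; split=> //; exact: triangle1.
have e1 : gs C C - gs C C0 = gC C - gC C0.
  apply: (compare _ _ _ (@triangle_cvx _ _ p0 p0 (p C)) (seg_nice C cC) (hgs C cC)) => //.
    exact: exact_sub hgC.
  by exists (p C); split=> //; exact: triangle3.
have e2 : gs D D - gs D C0 = gD D - gD C0.
  apply: (compare _ _ _ (@triangle_cvx _ _ p0 p0 (p D)) (seg_nice D cD) (hgs D cD)) => //.
    exact: exact_sub hgD.
  by exists (p D); split=> //; exact: triangle3.
have e3 : gD D - gD C0 = gC D - gC C0.
  apply: (compare _ _ _ (@triangle_cvx _ _ p0 p0 qH)) => //.
  - by move=> x /qC/nC.
  - exact: exact_sub hgD.
  - exact: exact_sub hgC.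
  - by exists qH; split=> //; exact: triangle3.
rewrite e1 e2 e3 -(hgC qH _ C D aCD Cq Dq); first by vec.
exact: triangle3.
Qed.

End Potential.

(** * Strictly convex support functions *)

Section Support.
Context {R : realType} {d : nat}.
Local Notation E := 'rV[R]_d.
Context {F : set (set E)} {v : E} (HF : fan_at F v).
Implicit Types (x y w u n : E) (A B C D K H T : set E).

(** The function that is dot (a C) (x - v) on each cell C is the maximum of
these linear forms, and the cells are its domains of linearity. *)
Definition support_vectors (a : set E -> E) := forall C D x, cell F C -> cell F D -> C x ->
  dot (a D) (x - v) <= dot (a C) (x - v) /\
  (dot (a D) (x - v) = dot (a C) (x - v) -> D x).

(** The segment from a generic point p of C to x leaves C at a point other
than x, which lies in no member of codimension at least 2; hence the next cell
D meets C in a hyperface. The scalar product of the normal with points of the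
segment, taken from v, is negative at p and vanishes at the exit point, so it
is positive at x. *)
Lemma exit_cell C x : cell F C -> ~ C x -> exists D n,
  [/\ adj F C D, unit_normal (C `&` D) C D n & 0 < dot n (x - v)].
Proof.
move=> cC nCx; have [fs hfs] := fan_seq HF.
have /choice[f hf] : forall A, exists U, F A -> direction A U.
  move=> A; have [FA|] := pselect (F A); last by exists fullv.
  by have [U [z [dU _]]] := mem_dir HF FA; exists U.
have dC : \dim (f C) = d by rewrite -[RHS](codim_dir cC (hf C cC.1)) addn0.
(* p avoids the directions of codimension at least 2 enlarged by x - v, so
   that the exit point is in no member of codimension at least 2; it also
   avoids the proper directions, so that it is not on the hyperplane of the
   exit hyperface *)
pose small := [seq (W + <[x - v]>)%VS | W <- [seq W <- map f fs | ((\dim W).+1 < d)%N]].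
pose walls := [seq W <- map f fs | (\dim W < d)%N].
have [W|p Cp hp] := avoid_directions HF (ws := small ++ walls) cC.1 (hf _ cC.1).
  rewrite mem_cat mem_filter => /orP[/mapP[V]|/andP[Wd _] /dimvS]; last first.
    by rewrite dC leqNgt Wd.
  rewrite mem_filter => /andP[Vd _] -> /dimvS; rewrite dC => h.
  by have := leq_ltn_trans (leq_trans h (dim_addline_le _ _)) Vd; rewrite ltnn.
pose pt t := p + t *: (x - p).
pose S := [set t | 0 <= t <= 1 /\ C (pt t)].
have S0 : S 0 by split; [rewrite lexx ler01|rewrite /pt scale0r addr0].
have hS : has_sup S by split; [exists 0|exists 1 => t [/andP[]]].
pose t := sup S.
have t0 : 0 <= t by exact: (ub_le_sup hS.2).
have t1 : t <= 1 by apply: ge_sup => [|s [/andP[]]]; [exists 0|].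
have [e e0 he] := line_near HF p (x - p) t.
have Ct : C (pt t).
  have [s [s01 Cs] ts] := sup_adherent e0 hS.
  have st : s <= t by apply: (ub_le_sup hS.2).
  apply: (he (s - t)); [|exact: cC.1|by rewrite [t + _]addrC subrK].
  by rewrite -/t in ts; rewrite ltr_norml; apply/andP; split; lra.
have tlt : t < 1.
  rewrite lt_neqAle t1 andbT; apply/eqP => tE; apply: nCx.
  by move: Ct; rewrite tE /pt scale1r addrC subrK.
pose r := Num.min (e / 2) (1 - t).
have r0 : 0 < r by rewrite lt_min; apply/andP; split; lra.
have re : r <= e / 2 by rewrite ge_min lexx.
have r1 : r <= 1 - t by rewrite ge_min lexx orbT.
have [D [cD Ds]] := cells_cover HF (pt (t + r)).
have Dt : D (pt t).
  by apply: (he r) => //; [rewrite gtr0_norm //; lra|exact: cD.1].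
have CD : C <> D.
  move=> CD; have : t + r <= t.
    apply: (ub_le_sup hS.2); split; first by apply/andP; split; lra.
    by rewrite CD.
  lra.
have FCD := mem_cap HF cC.1 cD.1; have dV := hf _ FCD; set V := f _ in dV.
have Vf : V \in map f fs by apply: map_f; apply/hfs.
have CDv : (C `&` D) v by split; apply: (mem_vertex HF); [exact: cC.1|exact: cD.1].
have yV : pt t - v \in V by apply: dV.1.
have Vd := cap_dim HF cC cD CD dV.
have V1 : (\dim V + 1)%N = d.
  apply/eqP; rewrite addn1 eqn_leq Vd leqNgt; apply/negP => Vs.
  have /hp/negP : (V + <[x - v]>)%VS \in small ++ walls.
    rewrite mem_cat; apply/orP; left; apply: map_f.
    by rewrite mem_filter Vf Vs.
  apply; have t1' : 1 - t != 0 by apply/eqP; lra.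
  have -> : p - v = (1 - t)^-1 *: ((pt t - v) - t *: (x - v)) by rewrite /pt; vec.
  rewrite memvZ // rpredB //; first exact: (subvP (addvSl _ _)).
  by rewrite memvZ //; apply: (subvP (addvSr _ _)); exact: memv_line.
have aCD : adj F C D by split=> //; apply: (dir_codim HF FCD dV).
have [n un] := adj_normal HF aCD; exists D, n; split=> //.
have [U [z [dU rz]]] := mem_dir HF FCD; rewrite (direction_uniq dU dV) in rz.
have pn := unit_normal_perp rz un.
have ny : dot n (pt t - v) = 0 by apply: pn.
have np : dot n (p - v) < 0.
  rewrite lt_neqAle; apply/andP; split; last by case: un => _ _ h _; apply: h.
  apply/eqP => np; have /hp/negP : V \in small ++ walls.
    by rewrite mem_cat mem_filter Vf Vd orbT.
  apply; have := perp_decomp (p - v) V1 pn (unit_normal_neq0 un).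
  by rewrite np mul0r scale0r subr0.
have : dot n (pt t - v) = (1 - t) * dot n (p - v) + t * dot n (x - v).
  by rewrite -!dotZr -dotDr; congr (dot n _); rewrite /pt; vec.
rewrite ny => e1; have h1 : (1 - t) * dot n (p - v) < 0 by rewrite pmulr_rlt0 // subr_gt0.
rewrite ltNge; apply/negP => h2.
have h3 : t * dot n (x - v) <= 0 by rewrite mulr_ge0_le0.
by clear - e1 h1 h3; lra.
Qed.

Lemma seq_argmax (T : eqType) (s : seq T) (f : T -> R) i0 : i0 \in s ->
  exists2 i, i \in s & forall j, j \in s -> f j <= f i.
Proof.
elim: s i0 => // i s IH i0 _; case: s IH => [_|i1 s /(_ i1 (mem_head _ _))[k ks hk]].
  by exists i; rewrite ?mem_head // => j; rewrite inE => /eqP->.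
have [h|/ltW h] := leP (f k) (f i).
  exists i; rewrite ?mem_head // => j; rewrite inE => /orP[/eqP->//|/hk].
  by move/le_trans; apply.
exists k; first by rewrite inE ks orbT.
by move=> j; rewrite inE => /orP[/eqP->//|/hk].
Qed.

(** If C has the largest value at x among all cells, then C contains x, since
crossing a hyperface towards x increases the value. For an interior point of a
cell this singles out the cell; the inequality extends to the whole cell by
letting an interior point tend to x. *)
Lemma support_of_potential (s : set E -> R) (g : set E -> E) : fan_scaling F s ->
  (forall C D, adj F C D -> g D - g C = jump s C D) -> support_vectors g.
Proof.
move=> spos hg.
have bigger C x : cell F C -> ~ C x ->
    exists2 D, cell F D & dot (g C) (x - v) < dot (g D) (x - v).
  move=> cC /(exit_cell cC)[D [n [aCD un nx]]]; have [_ cD _ hH] := aCD.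
  exists D => //; rewrite -subr_gt0 -dotBl (hg _ _ aCD) (jumpE HF s aCD un) dotZl.
  by rewrite mulr_gt0 // spos.
have [fs hfs] := fan_seq HF.
have top x : exists C, [/\ cell F C, C x & forall D, cell F D ->
    dot (g D) (x - v) <= dot (g C) (x - v)].
  pose cs := [seq C <- fs | `[< cell F C >]].
  have csP C : cell F C <-> C \in cs.
    rewrite mem_filter; split=> [cC|/andP[/asboolP//]].
    by apply/andP; split; [exact/asboolP|apply/hfs; exact: cC.1].
  have [C0 [/csP cC0 _]] := cells_cover HF x.
  have [C /csP cC hC] := seq_argmax (fun C => dot (g C) (x - v)) cC0.
  have hC' D : cell F D -> dot (g D) (x - v) <= dot (g C) (x - v) by move/csP/hC.
  exists C; split=> //; apply: contrapT => /(bigger C x cC)[D /hC'].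
  by rewrite leNgt => /negP.
have sup C D x : cell F C -> cell F D -> C x ->
    dot (g D) (x - v) <= dot (g C) (x - v).
  move=> cC cD Cx; have [x0 Cx0] := cell_interior HF cC.
  have int y : C° y -> dot (g D) (y - v) <= dot (g C) (y - v).
    move=> Cy; have [A [cA Ay hA]] := top y.
    by rewrite (cell_inj HF cC.1 cA.1 Cy Ay); exact: hA.
  rewrite leNgt; apply/negP; rewrite -subr_gt0 -dotBl => lt.
  have := int x0 Cx0; rewrite -subr_le0 -dotBl => le0.
  set a := dot _ _ in lt; set b := dot _ _ in le0.
  (* a > 0 is the value at x and b <= 0 the value at x0 of the difference of
     the two forms; at the parameter t its value is still a / 2 *)
  pose t := a / (2 * (a - b)).
  have ab : 0 < 2 * (a - b) by lra.
  have t0 : 0 < t by rewrite divr_gt0.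
  have t1 : t <= 1 by rewrite ler_pdivrMr //; lra.
  have := int _ (interior_mix HF cC.1 Cx Cx0 (t := t) _); rewrite t0 => /(_ t1).
  rewrite -subr_le0 -dotBl.
  have -> : x + t *: (x0 - x) - v = (1 - t) *: (x - v) + t *: (x0 - v) by vec.
  rewrite dotDr !dotZr -/a -/b.
  have -> : (1 - t) * a + t * b = a - t * (2 * (a - b)) / 2 by field.
  by rewrite /t divfK ?lt0r_neq0 //; lra.
move=> C D x cC cD Cx; split; first exact: sup.
move=> e; apply: contrapT => /(bigger D x cD)[A cA].
by rewrite e ltNge sup.
Qed.

Lemma support_inj a C D : support_vectors a -> cell F C -> cell F D -> a C = a D -> C = D.
Proof.
move=> sa cC cD e; have [x Cx] := cell_interior HF cC.
apply: (cell_inj HF cC.1 cD.1 Cx).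
by have [_] := sa C D x cC cD (interior_mem Cx); apply; rewrite e.
Qed.

(** The jump a(D) - a(C) between adjacent cells vanishes on their common
hyperface and increases towards D: it is a positive multiple of the unit
normal. With s(H) equal to its length, the torsion is a cyclic sum of
differences. A hyperface is in at most two cells, so s is well defined. *)
Lemma canonical_of_support a : support_vectors a ->
  exists s, fan_scaling F s /\ canonical_scaling F s.
Proof.
move=> sa; pose norm x : R := Num.sqrt (dot x x).
pose P H := [set r | exists C D, [/\ adj F C D, C `&` D = H & r = norm (a D - a C)]].
pose s H := xget 1 (P H).
have normN x : norm (- x) = norm x by rewrite /norm dotNl dotNr opprK.
have sE C D : adj F C D -> s (C `&` D) = norm (a D - a C).
  move=> aCD; have [cC cD CD hH] := aCD.
  have /(@xgetPex _ 1 (P (C `&` D))) : exists r, P (C `&` D) r.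
    by exists (norm (a D - a C)), C, D.
  rewrite -/(s _) => -[C' [D' [aCD' e ->]]].
  have [cC' cD' CD' _] := aCD'.
  have [sC sD] : C `&` D `<=` C /\ C `&` D `<=` D by split=> y [].
  have [sC' sD'] : C `&` D `<=` C' /\ C `&` D `<=` D' by rewrite -e; split=> y [].
  have [CC|/eqP CC] := eqVneq C C'.
    have -> // : D' = D; last by rewrite CC.
    by apply/esym; apply: (two_cells HF hH cC cD cD') => //; rewrite CC.
  have DC : D = C' by apply: (two_cells HF hH cC cD cC').
  have -> : D' = C.
    by apply: (two_cells HF hH cD cD' cC) => //; [rewrite DC|exact/nesym].
  by rewrite -DC -opprB normN.
have norm0 x : x != 0 -> 0 < norm x by move=> x0; rewrite sqrtr_gt0 dot_gt0.
have aneq C D : adj F C D -> a D - a C != 0.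
  move=> [cC cD CD _]; rewrite subr_eq0; apply/eqP => e; apply: CD.
  exact/esym/(support_inj sa cD cC).
exists s; split=> [H hH|K hK].
  rewrite /s; case: xgetP => [r _ [C [D [aCD _ ->]]]|_]; last exact: ltr01.
  exact/norm0/aneq.
have [k [L cyc]] := cyclic_exists HF hK.
have [aL _] := cyclic_adj HF hK cyc.
exists k, L, (fun i => (norm (a (L (ordS i)) - a (L i)))^-1 *: (a (L (ordS i)) - a (L i))).
split=> // [i|].
  have := aL i; set C := L i; set D := L _ => aCD; have [cC cD _ _] := aCD.
  set b := a D - a C; have b0 : 0 < norm b by apply/norm0/aneq.
  have eH y : (C `&` D) y -> dot b (y - v) = 0.
    move=> [Cy Dy]; apply/eqP; rewrite dotBl subr_eq0; apply/eqP/le_anti.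
    by rewrite (sa C D y cC cD Cy).1 (sa D C y cD cC Dy).1.
  have db y x : dot b (y - x) = dot b (y - v) - dot b (x - v).
    by rewrite -dotBr; congr (dot b _); vec.
  split=> [|x y Hx Hy|x y Hx Cy|x y Hx Dy]; rewrite ?dotZl ?dotZr.
  - rewrite mulrA -expr2 exprVn sqr_sqrtr ?dot_ge0 // mulVf //.
    by rewrite dot_eq0; exact: aneq.
  - by rewrite db !eH // subrr mulr0.
  - rewrite pmulr_rle0 ?invr_gt0 // db (eH x Hx) subr0 dotBl subr_le0.
    by have [] := sa C D y cC cD Cy.
  - rewrite pmulr_rge0 ?invr_gt0 // db (eH x Hx) subr0 dotBl subr_ge0.
    by have [] := sa D C y cD cC Dy.
under eq_bigr => i _ do rewrite sE // scalerA divff ?lt0r_neq0 ?scale1r ?norm0 ?aneq //.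
rewrite sumrB [X in X - _](_ : _ = \sum_i a (L i)) ?subrr //.
by rewrite [RHS](reindex_inj (can_inj (@ordSK k))).
Qed.

End Support.
Arguments support_vectors {R d} F v a.

(** * Cones over sets, and faces of a polytope *)

Section ConeAt.
Context {R : realType} {d : nat}.
Local Notation E := 'rV[R]_d.
Implicit Types (x y w u n v : E) (A B C D K H T : set E).

Lemma cone_at_vertex v B : cone_at v B v.
Proof.
exists 0%N, (fun=> v), (fun=> 0); split=> [[]//|[]//|].
by rewrite big_ord0 addr0.
Qed.

Lemma cone_at_step v B x p a : cone_at v B x -> B p -> 0 <= a ->
  cone_at v B (x + a *: (p - v)).
Proof.
move=> [k [q [b [Bq b0 ->]]]] Bp a0.
exists k.+1, (fun i => oapp q p (unlift ord0 i)), (fun i => oapp b a (unlift ord0 i)).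
split=> [i|i|]; try by case: unliftP => [i'|] _ /=.
rewrite big_ord_recl unlift_none /= -addrA; congr (_ + _); rewrite addrC.
by congr (_ + _); apply: eq_bigr => i _; rewrite liftK.
Qed.

(** Terms with zero coefficient are dropped, so their points need not be in
B. *)
Lemma cone_at_sum v B I (r : seq I) (a : I -> R) (p : I -> E) :
  (forall i, 0 <= a i) -> (forall i, a i != 0 -> B (p i)) ->
  cone_at v B (v + \sum_(i <- r) a i *: (p i - v)).
Proof.
move=> a0 Bp; elim: r => [|i r IH].
  by rewrite big_nil addr0; exact: cone_at_vertex.
rewrite big_cons addrCA addrC; have [->|ai] := eqVneq (a i) 0.
  by rewrite scale0r addr0.
by apply: cone_at_step => //; exact: Bp.
Qed.

(** The missing weight is put on v. *)
Lemma cvx_comb A v I (r : seq I) (a : I -> R) (p : I -> E) : cvxset A -> A v ->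
  (forall i, 0 <= a i) -> (forall i, A (p i)) -> \sum_(i <- r) a i <= 1 ->
  A (v + \sum_(i <- r) a i *: (p i - v)).
Proof.
move=> cA Av + Ap; elim: r a => [|i r IH] a a0; first by rewrite !big_nil addr0.
rewrite !big_cons => h.
have rest0 : 0 <= \sum_(j <- r) a j by apply: sumr_ge0.
have [ai|ai] := eqVneq (a i) 1.
  have z : \sum_(j <- r) a j *: (p j - v) = 0.
    have : \sum_(j <- r) a j = 0 by rewrite ai in h; lra.
    elim: r {IH h rest0} => [|j r IHr]; first by rewrite !big_nil.
    rewrite !big_cons => /eqP; rewrite paddr_eq0 ?sumr_ge0 // => /andP[/eqP-> /eqP/IHr->].
    by rewrite scale0r add0r.
  by rewrite z ai scale1r addr0 addrC subrK.
have c0 : 0 < 1 - a i by rewrite subr_gt0 lt_neqAle ai; lra.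
have := IH (fun j => a j / (1 - a i)) _ _.
rewrite -mulr_suml ler_pdivrMr // mul1r => /(_ _ _)/= Ay.
have {}Ay : A (v + \sum_(j <- r) (a j / (1 - a i)) *: (p j - v)).
  by apply: Ay => [j|]; [rewrite divr_ge0 // ltW|lra].
have := cA _ _ (a i) Ay (Ap i); rewrite a0 => /(_ _)/= Az.
have {}Az := Az (_ : a i <= 1).
have -> : \sum_(j <- r) a j *: (p j - v) =
    (1 - a i) *: \sum_(j <- r) (a j / (1 - a i)) *: (p j - v).
  rewrite scaler_sumr; apply: eq_bigr => j _.
  by rewrite scalerA mulrC divfK // lt0r_neq0.
move: Az; set y := \sum_(j <- r) _ => Az.
have -> : v + (a i *: (p i - v) + (1 - a i) *: y) =
   v + y + a i *: (p i - (v + y)) by vec.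
by apply: Az; lra.
Qed.

End ConeAt.

Section PolytopalSupport.
Context {R : realType} {d : nat}.
Local Notation E := 'rV[R]_d.
Context {F : set (set E)} {v : E} (HF : fan_at F v).
Implicit Types (x y w u n : E) (A B C D K H T : set E).

(** As v is interior to M, it is not on the hyperplane of a proper face, so
the inequality can be normalised to have value 0 at v and 1 on the face. The
empty face is included: its form may be 0. *)
Lemma proper_face_form M B : M° v -> face M B -> B <> M -> exists a : E,
  (forall x, M x -> dot a (x - v) <= 1) /\
  B = M `&` [set x | dot a (x - v) = 1].
Proof.
move=> Mv [c [b [cb BE]]] BM; have Mv' := interior_mem Mv.
have lt : 0 < b - dot c v.
  rewrite subr_gt0 lt_neqAle cb // andbT; apply/eqP => e; apply: BM.
  have c0 := core_perp0 Mv cb e.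
  rewrite BE c0 -e c0; apply/seteqP; split=> [y []|y My] //.
  by split=> //=; rewrite !dot0l.
exists ((b - dot c v)^-1 *: c); split=> [x Mx|].
  by rewrite dotZl mulrC ler_pdivrMr // mul1r dotBr lerB // cb.
rewrite BE; apply/seteqP; split=> x [Mx /= h]; split=> //=.
  by rewrite dotZl dotBr h mulVf // lt0r_neq0.
move: h; rewrite dotZl dotBr mulrC => /(canRL (divfK (lt0r_neq0 lt))).
by rewrite mul1r => /addIr.
Qed.

(** A point of the cell C is v plus a nonnegative combination of vectors from
v to points of M where a(C) = 1. There a(D) is at most 1, and equality of the
two forms forces a(D) = 1 at all the points that occur, so that the point is
in the cell D. *)
Lemma support_of_polytopal : polytopal_fan F -> exists a, support_vectors F v a.
Proof.
move=> [M [v0 [_ _ Mv FE]]].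
have vE : v = v0.
  have : F [set v0].
    rewrite FE; exists set0; split.
    - exists 0, 1; split=> [x _|]; first by rewrite dot0l ler01.
      apply/seteqP; split=> // x [_ /=]; rewrite dot0l => /eqP.
      by rewrite eq_sym oner_eq0.
    - by move=> e; have := interior_mem Mv; rewrite -e.
    - apply/seteqP; split=> [_ ->|x [k [p [a [hp _ ->]]]]].
        exact: cone_at_vertex.
      by rewrite big1 ?addr0 // => i; have := hp i.
  by move/(mem_vertex HF).
rewrite -{}vE in Mv FE.
have /choice[a ha] : forall C, exists a, F C -> exists B,
    [/\ C = cone_at v B, forall x, M x -> dot a (x - v) <= 1 &
        B = M `&` [set x | dot a (x - v) = 1]].
  move=> C; have [|] := pselect (F C); last by exists 0.
  rewrite {1}FE => -[B [fB BM ->]]; have [a [a1 a2]] := proper_face_form Mv fB BM.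
  by exists a => _; exists B.
exists a => C D x cC cD; have [B [CE a1 a2]] := ha C cC.1.
have [B' [DE a1' a2']] := ha D cD.1.
move=> Cx; have {Cx} : cone_at v B x by rewrite -CE.
move=> [k [p [al [Bp al0 ->]]]].
have MB i : M (p i) /\ dot (a C) (p i - v) = 1 by have := Bp i; rewrite a2 => -[Mp e]; split.
have term i : 0 <= al i * dot (a C) (p i - v) - al i * dot (a D) (p i - v).
  rewrite (MB i).2 -mulrBr mulr_ge0 // subr_ge0; apply: a1'.
  exact: (MB i).1.
rewrite addrC addKr !dot_sumr.
under eq_bigr do rewrite dotZr.
under [X in _ <= X]eq_bigr do rewrite dotZr.
split; first by rewrite -subr_ge0 -sumrB sumr_ge0.
under [X in _ = X -> _]eq_bigr do rewrite dotZr.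
move/esym/eqP; rewrite -subr_eq0 -sumrB psumr_eq0 // => /allP h.
rewrite DE; apply: cone_at_sum => // i ai; rewrite a2'; split; first exact: (MB i).1.
have := h i (mem_index_enum i); rewrite /= (MB i).2 -mulrBr mulf_eq0 (negPf ai) /=.
by rewrite subr_eq0 => /eqP.
Qed.

End PolytopalSupport.

(** * Convex hulls *)

Lemma addvK (V : zmodType) (x y : V) : x + y - x = y.
Proof. by rewrite addrC addKr. Qed.

Section Hull.
Context {R : realType} {d : nat}.
Local Notation E := 'rV[R]_d.
Implicit Types (x y w u n v c : E) (A B C D K H T : set E) (P : seq E).

Definition hull P : set E := [set x | exists al : 'I_(size P) -> R,
  [/\ forall i, 0 <= al i, \sum_i al i = 1 & x = \sum_i al i *: P`_i]].

Lemma hull_cvx P : cvxset (hull P).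
Proof.
move=> _ _ t [a [a0 a1 ->]] [b [b0 b1 ->]] /andP[t0 t1].
exists (fun i => (1 - t) * a i + t * b i); split=> [i||].
- by rewrite addr_ge0 // mulr_ge0 // subr_ge0.
- by rewrite big_split /= -!mulr_sumr a1 b1; ring.
under [RHS]eq_bigr do rewrite scalerDl -!scalerA.
rewrite big_split /= -!scaler_sumr.
by move: (\sum_i a i *: _) (\sum_i b i *: _) => p q; vec.
Qed.

Lemma hull_mem P p : p \in P -> hull P p.
Proof.
move=> pP; have hi : (index p P < size P)%N by rewrite index_mem.
pose i0 := Ordinal hi; exists (fun i => (i == i0)%:R); split=> [i||].
- by rewrite ler0n.
- by rewrite (bigD1 i0) //= eqxx big1 ?addr0 // => i /negPf->.
rewrite (bigD1 i0) //= eqxx scale1r nth_index // big1 ?addr0 // => i /negPf->.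
by rewrite scale0r.
Qed.

Lemma hull_le P c b x : (forall p, p \in P -> dot c p <= b) -> hull P x ->
  dot c x <= b.
Proof.
move=> h [a [a0 a1 ->]]; rewrite dot_sumr -[b]mul1r -a1 mulr_suml.
by apply: ler_sum => i _; rewrite dotZr ler_wpM2l // h // mem_nth.
Qed.

End Hull.

(** * The polytope of a support function *)

Section SupportPolytopal.
Context {R : realType} {d : nat}.
Local Notation E := 'rV[R]_d.
Context {F : set (set E)} {v : E} (HF : fan_at F v).
Implicit Types (x y w u n c : E) (A B C D K H T : set E).

(** The vertex is a face of D, so it is not a midpoint of two other points of
D. *)
Lemma vertex_extreme D x : F D -> D x -> D (v + v - x) -> x = v.
Proof.
move=> FD Dx Dy; have [c [b [cb e]]] := cap_face HF FD (vertex_mem HF).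
have ev : dot c v = b.
  have : (D `&` [set v]) v by split=> //; exact: (mem_vertex HF).
  by rewrite e => -[].
have eb : dot c x = b.
  by have := cb _ Dx; have := cb _ Dy; rewrite dotBr dotDr ev => *; lra.
by have : (D `&` [set v]) x; [rewrite e|case].
Qed.

Lemma cell_seq : exists cs : seq (set E), forall C, cell F C <-> C \in cs.
Proof.
have [fs hfs] := fan_seq HF; exists [seq C <- fs | `[< cell F C >]] => C.
rewrite mem_filter; split=> [cC|/andP[/asboolP//]].
by apply/andP; split; [exact/asboolP|apply/hfs; exact: cC.1].
Qed.

(** The mean of the a(D) is subtracted. The difference of a maximum and a mean
vanishes at x only if all the cells contain x; one of the cells also contains
the reflection of x in v, and then x = v. *)
Lemma support_positive a : support_vectors F v a -> exists2 a', support_vectors F v a' &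
  forall C x, cell F C -> C x -> x <> v -> 0 < dot (a' C) (x - v).
Proof.
move=> sa; have [cs csP] := cell_seq.
pose l := (size cs)%:R^-1 *: \sum_(D <- cs) a D.
exists (fun C => a C - l) => [C D x cC cD Cx|C x cC Cx xv].
  have [h1 h2] := sa C D x cC cD Cx; rewrite !dotBl lerD2r; split=> // e.
  by apply: h2; move: e => /addIr.
have N0 : 0 < (size cs)%:R :> R.
  by rewrite ltr0n; move/csP: cC; case: cs {l csP}.
rewrite -(pmulr_rgt0 _ N0) dotBl mulrBr dotZl mulrA divff ?lt0r_neq0 // mul1r.
rewrite dot_suml mulr_natl -[X in _ *+ X]sum1_size -sumrMnr -sumrB.
under eq_bigr do rewrite mulr1n.
have term D : D \in cs -> 0 <= dot (a C) (x - v) - dot (a D) (x - v).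
  by move/csP => cD; rewrite subr_ge0; have [] := sa C D x cC cD Cx.
rewrite lt_def big_seq sumr_ge0 // andbT psumr_eq0 //; apply/negP => /allP h.
have [D [cD Dy]] := cells_cover HF (v + v - x).
apply: xv; apply: (vertex_extreme cD.1 _ Dy).
have [_] := sa C D x cC cD Cx; apply.
have Ds := (csP D).1 cD; have := h D Ds; rewrite Ds /= subr_eq0.
by move/eqP.
Qed.

Context (a : set E -> E) (sa : support_vectors F v a).
Context (posa : forall C x, cell F C -> C x -> x <> v -> 0 < dot (a C) (x - v)).

(** The generators g of a cell C are scaled so that a(C) is 1. The vertex
itself is added as a convenient point for the missing weight in convex
combinations. *)
Lemma normalized_points : exists P : seq E, [/\ v \in P,
  forall p, p \in P -> p = v \/ exists C, [/\ cell F C, C p & dot (a C) (p - v) = 1] &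
  forall x, (forall C, cell F C -> dot (a C) (x - v) <= 1) -> hull P x].
Proof.
have [cs csP] := cell_seq.
have /choice[gs hgs] : forall C, exists g : seq E, F C ->
    (forall x, x \in g -> C (v + x)) /\
    (forall x, C x -> exists k (h : 'I_k -> E) (al : 'I_k -> R),
       [/\ forall i, h i \in g, forall i, 0 <= al i & x = v + \sum_i al i *: h i]).
  move=> C; have [FC|] := pselect (F C); last by exists [::].
  have [k [g CE]] := mem_gen HF FC; exists (codom g) => _; split.
    move=> _ /codomP[i ->]; rewrite CE; exists (fun j => (j == i)%:R).
      by move=> j; rewrite ler0n.
    rewrite (bigD1 i) //= eqxx scale1r big1 ?addr0 // => j /negPf->.
    by rewrite scale0r.
  move=> x; rewrite CE => -[al al0 ->]; exists k, g, al; split=> // i.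
  exact: codom_f.
pose pt C g := v + (dot (a C) g)^-1 *: g.
pose P := v :: [seq pt C g | C <- cs, g <- gs C].
have vP : v \in P by rewrite mem_head.
have pos C g : cell F C -> g \in gs C -> g != 0 -> 0 < dot (a C) g.
  move=> cC gg g0; have Cg := (hgs C cC.1).1 g gg.
  have vg : v + g - v = g by rewrite addvK.
  have := posa cC Cg; rewrite vg; apply => e.
  by case/eqP: g0; rewrite -vg e subrr.
exists P; split=> //.
  move=> p; rewrite inE => /orP[/eqP->|]; first by left.
  move=> /allpairsPdep[C [g [/csP cC gg ->]]].
  have [->|g0] := eqVneq g 0; first by left; rewrite /pt scaler0 addr0.
  have pg := pos C g cC gg g0; right; exists C; split=> //.
    have Cg := (hgs C cC.1).1 g gg.
    have -> : pt C g = v + (dot (a C) g)^-1 *: (v + g - v) by rewrite addvK.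
    by apply: (mem_scale HF cC.1 Cg); rewrite invr_ge0 ltW.
  by rewrite /pt addvK dotZr mulVf // lt0r_neq0.
move=> x hx; have [C [cC Cx]] := cells_cover HF x.
have [k [g [al [gg al0 xE]]]] := (hgs C cC.1).2 x Cx.
have := hx C cC; rewrite xE => hC.
have -> : \sum_i al i *: g i = \sum_i (al i * dot (a C) (g i)) *: (pt C (g i) - v).
  apply: eq_bigr => i _; rewrite /pt addvK scalerA.
  have [->|g0] := eqVneq (g i) 0; first by rewrite !scaler0.
  by rewrite mulfK // lt0r_neq0 // pos.
apply: cvx_comb; first exact: hull_cvx.
- exact: hull_mem.
- move=> i; have [->|g0] := eqVneq (g i) 0; first by rewrite dot0r mulr0.
  by rewrite mulr_ge0 // ltW // pos.
- move=> i; apply: hull_mem; rewrite inE; apply/orP; right.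
  by apply/allpairsPdep; exists C, (g i); split=> //; apply/csP.
move: hC; rewrite addvK dot_sumr; apply: le_trans.
by rewrite le_eqVlt; apply/orP; left; apply/eqP/eq_bigr => i _; rewrite dotZr.
Qed.

Lemma vertex_interior M : (forall x, (forall C, cell F C -> dot (a C) (x - v) <= 1) -> M x) ->
  M° v.
Proof.
move=> hM; rewrite /interior /=; have [cs csP] := cell_seq.
suff : \forall x \near v, forall C, C \in cs -> dot (a C) (x - v) <= 1.
  by apply: filterS => x hx; apply: hM => C /csP/hx.
elim: cs {csP} => [|C cs IH]; first by near=> x.
have h : dot (a C) v < 1 + dot (a C) v by rewrite ltrDr.
have := @dot_continuous _ _ (a C) v _ (lt_nbhsl h).
move: IH; apply: filterS2 => x h1 h2 D; rewrite inE => /orP[/eqP->|]; last exact: h1.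
by rewrite dotBr lerBlDr ltW.
Unshelve. all: by end_near.
Qed.

Lemma interior_has_dim M : M° v -> has_dim M d.
Proof.
move=> Mv; split; first by exists v; exact: interior_mem.
exists fullv; last exact: dim_full.
split=> [x y _ _|W hW]; first exact: memvf.
apply/subvP => w _; have [e e0 /(_ e)] := interior_core w Mv.
rewrite lexx ltW // => /(_ isT) Mw.
rewrite -(scalerK (lt0r_neq0 e0) w) memvZ //.
have -> : e *: w = (v + e *: w) - v by rewrite addvK.
by apply: hW => //; exact: interior_mem.
Qed.

Section Faces.
Context (P : seq E) (vP : v \in P).
Hypothesis ptP : forall p, p \in P -> p = v \/
  exists C, [/\ cell F C, C p & dot (a C) (p - v) = 1].
Hypothesis hullP : forall x, (forall C, cell F C -> dot (a C) (x - v) <= 1) -> hull P x.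
Local Notation M := (hull P).

Lemma pt_le p C : p \in P -> cell F C -> dot (a C) (p - v) <= 1.
Proof.
move=> /ptP[->|[D [cD Dp <-]]] cC; first by rewrite subrr dot0r ler01.
by have [] := sa cD cC Dp.
Qed.

(** Together with hullP, this describes the hull by the inequalities a(C) <=
1. *)
Lemma hull_le1 x C : M x -> cell F C -> dot (a C) (x - v) <= 1.
Proof.
move=> Mx cC; rewrite dotBr lerBlDr; apply: hull_le Mx => p pP.
by rewrite -lerBlDr -dotBr pt_le.
Qed.

(** By homogeneity, comparisons between linear forms on a cell reduce to the
points of M where a(C) = 1. *)
Lemma normalize C x : cell F C -> C x -> x <> v ->
  let y := v + (dot (a C) (x - v))^-1 *: (x - v) in
  [/\ C y, M y, dot (a C) (y - v) = 1 & x = v + dot (a C) (x - v) *: (y - v)].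
Proof.
move=> cC Cx xv y; have r0 := posa cC Cx xv; set r := dot _ _ in y r0 *.
have Cy : C y by apply: (mem_scale HF cC.1 Cx); rewrite invr_ge0 ltW.
have y1 : dot (a C) (y - v) = 1.
  by rewrite /y addvK dotZr mulVf // lt0r_neq0.
split=> //; last by rewrite /y addvK scalerA divff ?lt0r_neq0 // scale1r addrC subrK.
by apply: hullP => D cD; rewrite -y1; have [] := sa cC cD Cy.
Qed.

(** The form a(C) is tilted by a multiple of c so small that, at the points
outside C, where a(C) is less than 1, the tilted form remains less than 1. *)
Lemma separating K C c : F K -> cell F C ->
  (forall x, C x -> dot c (x - v) <= 0) ->
  (forall x, C x -> dot c (x - v) = 0 -> K x) ->
  exists2 e, 0 < e & forall p, p \in P -> dot (a C + e *: c) (p - v) <= 1 /\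
    (dot (a C + e *: c) (p - v) = 1 -> K p).
Proof.
move=> FK cC c0 cK.
have [p pP|e e0 he] := @small_all _ _ P (fun p t => 0 < t ->
    dot (a C + t *: c) (p - v) <= 1 /\ (dot (a C + t *: c) (p - v) = 1 -> K p)).
  have p1 := pt_le pP cC.
  have [Cp|Cp] := pselect (C p).
    exists 1 => // t _ t0; rewrite dotDl dotZl; have cp := c0 _ Cp.
    have tc : t * dot c (p - v) <= 0 by rewrite pmulr_rle0.
    split=> [|e]; first by lra.
    have : t * dot c (p - v) = 0 by lra.
    move=> /eqP; rewrite mulf_eq0 gt_eqF //= => /eqP; exact: cK.
  have lt : 0 < 1 - dot (a C) (p - v).
    rewrite subr_gt0 lt_neqAle p1 andbT; apply/eqP => e; apply: Cp.
    have [pv|[D [cD Dp Dp1]]] := ptP pP.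
      by rewrite pv; exact: (mem_vertex HF cC.1).
    by have [_] := sa cD cC Dp; apply; rewrite e.
  pose q := `|dot c (p - v)| + 1; have q0 : 0 < q by rewrite ltr_wpDl.
  exists ((1 - dot (a C) (p - v)) / q / 2); first by rewrite !divr_gt0.
  move=> t /andP[_]; rewrite ler_pdivlMr // ler_pdivlMr // => ht t0.
  have le : t * dot c (p - v) <= t * q.
    by rewrite ler_wpM2l ?(ltW t0) // (le_trans (ler_norm _)) // lerDl.
  have tq : 0 < t * q by rewrite mulr_gt0.
  rewrite dotDl dotZl; split=> [|e]; [|exfalso]; lra.
by exists e => // p pP; apply: (he e) => //; rewrite lexx ltW.
Qed.

(** Let K be the face of a cell C that is cut out by c. Then the points of M
at which the tilted form a(C) + e c takes its maximum 1 are the points of K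
where a(C) = 1, and K is the cone over them. *)
Lemma fan_sub_face_fan K : F K -> face_fan M v K.
Proof.
move=> FK; have [U [z [dU rz]]] := mem_dir HF FK.
have [C [cC Cz]] := cells_cover HF z.
have KC := relint_sub HF cC.1 FK dU rz Cz.
have [c [b [cb]]] := cap_face HF cC.1 FK.
have -> : C `&` K = K by apply/setIidPr.
move=> KE.
have bv : dot c v = b by have := mem_vertex HF FK; rewrite KE => -[].
have c0 x : C x -> dot c (x - v) <= 0 by move=> /cb; rewrite dotBr bv subr_le0.
have cK x : C x -> dot c (x - v) = 0 -> K x.
  move=> Cx /eqP; rewrite dotBr bv subr_eq0 => /eqP e.
  by rewrite KE.
have cK' x : K x -> dot c (x - v) = 0 by rewrite dotBr bv KE => -[_ ->]; rewrite subrr.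
have [e e0 he] := separating FK cC c0 cK; set a' := a C + e *: c in he.
exists (M `&` [set x | dot a' x = 1 + dot a' v]); split.
- exists a', (1 + dot a' v); split=> // x Mx; apply: hull_le Mx => p /he[h _].
  by rewrite -lerBlDr -dotBr.
- move=> eM; have := hull_mem vP; rewrite -eM => -[_ /= /eqP].
  by rewrite -subr_eq0 opprD addrCA subrr addr0 oppr_eq0 oner_eq0.
apply/seteqP; split=> [x Kx|_ [k [p [al [Bp al0 ->]]]]].
  have [->|/eqP xv] := eqVneq x v; first exact: cone_at_vertex.
  have [Cy My y1 ->] := normalize cC (KC _ Kx) xv.
  set y := v + _ in Cy My y1 *; rewrite -/y.
  have Ky : K y.
    by apply: (mem_scale HF FK Kx); rewrite invr_ge0 ltW // posa //; exact: KC.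
  apply: cone_at_step; first exact: cone_at_vertex.
    split=> //=; have : dot a' (y - v) = 1 by rewrite dotDl dotZl cK' // mulr0 addr0.
    by rewrite dotBr => /eqP; rewrite subr_eq => /eqP.
  by rewrite ltW // posa //; exact: KC.
have Ksum I (r : seq I) (q : I -> E) (be : I -> R) : (forall i, 0 <= be i) ->
    (forall i, be i != 0 -> K (q i)) -> K (v + \sum_(i <- r) be i *: (q i - v)).
  move=> be0 Kq; elim: r => [|i r IH].
    by rewrite big_nil addr0; exact: (mem_vertex HF).
  rewrite big_cons; have [->|bi] := eqVneq (be i) 0; first by rewrite scale0r add0r.
  have := mem_add HF FK IH (mem_scale HF FK (Kq i bi) (be0 i)).
  by rewrite addvK -addrA [X in v + X]addrC.
apply: (@Ksum) => // i _; have [[be [be0 be1 pE]] /= p1] := Bp i.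
have sumE : p i - v = \sum_l be l *: (P`_l - v).
  under eq_bigr do rewrite scalerBr.
  by rewrite sumrB -scaler_suml be1 scale1r pE.
have -> : p i = v + (p i - v) by rewrite addrC subrK.
rewrite sumE; apply: (@Ksum) => // l bl.
have [h1] := he P`_l (mem_nth _ (ltn_ord l)); apply.
have : \sum_l be l * (1 - dot a' (P`_l - v)) = 0.
  under eq_bigr do rewrite mulrBr mulr1.
  rewrite sumrB be1; have : dot a' (p i - v) = 1 by rewrite dotBr p1 addrK.
  rewrite sumE dot_sumr; under eq_bigr do rewrite dotZr.
  by move->; rewrite subrr.
move=> /eqP; rewrite psumr_eq0 => [/allP/(_ l (mem_index_enum l))/=|l' _].
  by rewrite mulf_eq0 (negPf bl) /= subr_eq0 => /eqP.
by rewrite mulr_ge0 // subr_ge0; have [] := he P`_l' (mem_nth _ (ltn_ord l')).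
Qed.

(** Let c be the normalised form of the face. The cone over the face is the
set where c equals the function f = max a(C), and c is at most f everywhere.
It is thus the union of the faces KC C of the cells where c = a(C). Their
relative interior points add up to a point y of the cone, hence of some KC C0;
by maximality c = a(C0) at each of the summands as well, so KC C0 contains all
the KC C. *)
Lemma face_fan_sub_fan K : face_fan M v K -> F K.
Proof.
move=> [B [fB BM ->]]; have Mv := vertex_interior hullP.
have [c [c1 BE]] := proper_face_form Mv fB BM.
have cle C x : cell F C -> C x -> dot c (x - v) <= dot (a C) (x - v).
  move=> cC Cx; have [->|/eqP xv] := eqVneq x v; first by rewrite subrr !dot0r.
  have [Cy My y1 xE] := normalize cC Cx xv.
  have := c1 _ My; rewrite addvK dotZr mulrC ler_pdivrMr ?mul1r //.
  exact: posa.
pose KC C := C `&` [set x | dot c (x - v) = dot (a C) (x - v)].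
have KE : cone_at v B = [set x | exists2 C, cell F C & KC C x].
  apply/seteqP; split=> [_ [k [p [al [Bp al0 ->]]]]|x [C cC [Cx e]]].
    have [C [cC Cx]] := cells_cover HF (v + \sum_(i < k) al i *: (p i - v)).
    exists C => //; split=> //=; apply: le_anti; rewrite cle //=.
    rewrite addvK !dot_sumr; apply: ler_sum => i _; rewrite !dotZr.
    apply: ler_wpM2l => //; have := Bp i; rewrite BE => -[Mp /= ->].
    exact: hull_le1.
  have [->|/eqP xv] := eqVneq x v; first exact: cone_at_vertex.
  have [Cy My y1 ->] := normalize cC Cx xv.
  apply: cone_at_step; [exact: cone_at_vertex| |by rewrite ltW // posa].
  rewrite BE; split=> //=; rewrite addvK dotZr e mulVf //.
  by rewrite lt0r_neq0 // posa.
have FKC C : cell F C -> F (KC C).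
  move=> cC; case: HF => -[_ _ h _] _ _ _; apply: (h C) => //; first exact: cC.1.
    exists (c - a C), (dot (c - a C) v); split=> [x Cx|].
      by rewrite -subr_le0 -dotBr dotBl subr_le0 cle.
    apply/seteqP; split=> x [Cx /= e]; split=> //=.
      by apply/eqP; rewrite -subr_eq0 -dotBr dotBl e subrr.
    by apply/eqP; rewrite -subr_eq0 -dotBl dotBr e subrr.
  by exists v; split; [exact: (mem_vertex HF cC.1)|rewrite /= subrr !dot0r].
have [cs csP] := cell_seq.
have /choice[z hz] : forall C, exists z, cell F C ->
    exists2 U, direction (KC C) U & relint (KC C) U z.
  move=> C; have [cC|] := pselect (cell F C); last by exists v.
  by have [U [z [dU rz]]] := mem_dir HF (FKC C cC); exists z => _; exists U.
pose y := v + \sum_(C <- cs) (z C - v).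
have zB C : C \in cs -> cone_at v B (z C).
  by move=> /csP cC; rewrite KE; exists C => //; have [U _ []] := hz C cC.
have yB : cone_at v B y.
  suff h (r : seq (set E)) : (forall C, C \in r -> C \in cs) ->
      cone_at v B (v + \sum_(C <- r) (z C - v)) by exact: h.
  elim: r => [|C r IH] h; first by rewrite big_nil addr0; exact: cone_at_vertex.
  have [|k1 [p1 [al1 [Bp1 al10 zE]]]] := zB C; first by apply: h; exact: mem_head.
  have := IH _; set Y := v + _ => IH'.
  have {IH'} Yc : cone_at v B Y by apply: IH' => D Dr; apply: h; rewrite inE Dr orbT.
  rewrite big_cons addrCA addrC -/Y zE addvK => {zE}.
  elim: k1 p1 al1 Bp1 al10 => [|k1 IHk] p1 al1 Bp1 al10; first by rewrite big_ord0 addr0.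
  rewrite big_ord_recl addrCA addrC; apply: cone_at_step => //.
  by apply: (IHk (p1 \o lift ord0) (al1 \o lift ord0)) => i /=.
have [C0 cC0 [C0y ey]] : exists2 C, cell F C & KC C y by move: yB; rewrite KE.
suff -> : cone_at v B = KC C0 by exact: FKC.
apply/seteqP; split=> [x|x C0x]; rewrite KE; last by exists C0.
move=> [C cC]; have [U dU rz] := hz C cC.
suff : KC C `<=` KC C0 by apply.
apply: (relint_sub HF (FKC C0 cC0) (FKC C cC) dU rz).
have term D : D \in cs -> 0 <= dot (c - a C0) (z D - v).
  move=> /csP cD; have [_ _ [[Dz eD] _]] := hz D cD.
  rewrite dotBl subr_ge0 eD; by have [] := sa cD cC0 Dz.
have : \sum_(D <- cs) dot (c - a C0) (z D - v) = 0.
  have yE : \sum_(D <- cs) (z D - v) = y - v by rewrite /y addvK.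
  by rewrite -dot_sumr yE dotBl ey subrr.
move=> /eqP; rewrite big_seq psumr_eq0 // => /allP/(_ C ((csP C).1 cC)).
rewrite ((csP C).1 cC) /= dotBl subr_eq0 => /eqP e0.
have [[Cz eC] _] := rz; split=> //.
by have [_] := sa cC cC0 Cz; apply; rewrite -e0.
Qed.

End Faces.

Lemma polytopal_of_positive_support : polytopal_fan F.
Proof.
have [P [vP ptP hullP]] := normalized_points.
have Mv := vertex_interior hullP.
exists (hull P), v; split=> //.
- by exists (size P), (fun i => P`_i).
- exact: interior_has_dim.
apply/seteqP; split=> K; first exact: fan_sub_face_fan.
exact: face_fan_sub_fan.
Qed.

End SupportPolytopal.

Lemma polytopal_of_support (R : realType) (d : nat) (F : set (set 'rV[R]_d)) v a :
  fan_at F v -> support_vectors F v a -> polytopal_fan F.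
Proof.
move=> HF /(support_positive HF)[a' sa' posa'].
exact: (polytopal_of_positive_support HF sa' posa').
Qed.

Theorem mainTheorem1 (R : realType) (d : nat) (F : set (set 'rV[R]_d))
    (fanF : fan F) (completeF : complete_fan F) (pointedF : pointed_fan F) :
  (exists s : set 'rV[R]_d -> R, fan_scaling F s /\ canonical_scaling F s) <-> polytopal_fan F.
Proof.
have [v Fv memv] := pointedF; have HF : fan_at F v by [].
split=> [[s [spos canon]]|/(support_of_polytopal HF)[a sa]].
  have [g hg] := potential HF canon.
  exact: (polytopal_of_support HF (support_of_potential HF spos hg)).
exact: (canonical_of_support HF sa).
Qed.
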